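(* Let $(B\subset C,D\subset A)$ be a commuting square of simple unital $C^*$-algebras with a conditional expectation from $A$ onto $B$ of index-finite type. Let $\Theta=e_Ce_D\in B'\cap A_1$ be the angle operator, $\mathcal{F}:B'\cap A_1\to A'\cap A_2$ the Fourier transform, and $H$ the von Neumann entropy. Then $H(|\Theta|^2)=0$. Furthermore, in this case $$H\big(|\mathcal{F}(\Theta)|^2\big)=\eta\big([A:B]_0^{-1}\big).$$
   Context: All inclusions are unital (common identity); in a quadruple $(B\subset C,D\subset A)$, $C$ and $D$ are intermediate to $B\subset A$. A conditional expectation $E:A\to B$ is of index-finite type if there is a finite quasi-basis $\{\lambda_1,\dots,\lambda_n\}\subset A$, i.e. $x=\sum_i\lambda_iE(\lambda_i^*x)$ for all $x\in A$; then $\mathrm{Ind}_w(E)=\sum_i\lambda_i\lambda_i^*$ (Watatani index, a scalar when $A$ is simple). For simple unital $B\subset A$ with an expectation of index-finite type there is a unique minimal conditional expectation $E^A_B$ (the one of smallest index), and $[A:B]_0:=\mathrm{Ind}_w(E^A_B)=:\delta^2$. Tower: $A_1$ is the $C^*$-basic construction of $B\subset A$ with respect to $E^A_B$, i.e. the algebra of adjointable right $B$-linear maps of the Hilbert $B$-module $A$ (inner product $E^A_B(x^*y)$), generated by $A$ (left multiplication) and the Jones projection $e_1:a\mapsto E^A_B(a)$. Put $A_{-1}=B$, $A_0=A$; iterating gives $B\subset A\subset A_1\subset A_2\subset\cdots$ of simple unital $C^*$-algebras, with minimal conditional expectations $E^{A_k}_{A_{k-1}}$, and $e_{k+1}\in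 A_{k+1}$ is the Jones projection of $A_{k-1}\subset A_k$. The relative commutants $B'\cap A_k$ are finite-dimensional, and $\mathrm{tr}:=E^A_B\circ E^{A_1}_A\circ\cdots\circ E^{A_k}_{A_{k-1}}$ restricted to $B'\cap A_k$ is a faithful tracial state (compatible for different $k$). Intermediate algebras: for an intermediate simple unital $C^*$-subalgebra $B\subset C\subset A$ there are minimal conditional expectations $E^A_C$ and $E^C_B=E^A_B|_C$ with $E^A_B=E^C_B\circ E^A_C$. The Jones projection $e_C$ of $E^A_C$ is the map $a\mapsto E^A_C(a)$, viewed as an element of $B'\cap A_1$. Similarly for $D$. The quadruple is a commuting square if $E^A_CE^A_D=E^A_DE^A_C=E^A_B$. Fourier transform: $\mathcal{F}(x)=\delta^3E^{B'\cap A_2}_{A'\cap A_2}(xe_2e_1)$ for $x\in B'\cap A_1$, where $E^{B'\cap A_2}_{A'\cap A_2}(y)=\frac{1}{[A:B]_0}\sum_i\lambda_iy\lambda_i^*$ is the trace-preserving conditional expectation, $\{\lambda_i\}$ being a quasi-basis of $E^A_B$. Entropy: $\eta(t)=-t\log t$ for $t>0$, $\eta(0)=0$. For $x$ in $B'\cap A_1$ or in $A'\cap A_2$, $|x|^2=x^*x$ and $H(|x|^2)=\mathrm{tr}(\eta(|x|^2))$ (functional calculus). *)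

(* Defs.v *)
From HB Require Import structures.
From mathcomp Require Import all_boot all_order all_algebra.
From mathcomp Require Import all_classical all_reals all_analysis.
From mathcomp Require Import complex.

Set Implicit Arguments.
Unset Strict Implicit.
Unset Printing Implicit Defensive.

Import Order.TTheory GRing.Theory Num.Theory.
Import numFieldNormedType.Exports.

Local Open Scope classical_set_scope.
Local Open Scope complex_scope.
Local Open Scope ring_scope.

(* Unital complex C*-algebras. The norm is a separate field because the library
   hierarchy does not allow the join of GRing.Algebra with its normed modules. *)
HB.mixin Record isCStar (R : realType) A & GRing.Algebra R[i] A := {
  star : A -> A ;
  cnorm : A -> R ;
  starK : involutive star ;
  starD : {morph star : x y / x + y} ;
  starZ : forall (c : R[i]) (x : A), star (c *: x) = c^* *: star x ;
  starM : forall x y : A, star (x * y) = star y * star x ;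
  cnorm_eq0 : forall x : A, cnorm x = 0 -> x = 0 ;
  cnormD : forall x y : A, cnorm (x + y) <= cnorm x + cnorm y ;
  cnormZ : forall (c : R[i]) (x : A), (cnorm (c *: x))%:C = `|c| * (cnorm x)%:C ;
  cnormM : forall x y : A, cnorm (x * y) <= cnorm x * cnorm y ;
  cnorm_star : forall x : A, cnorm (star x * x) = cnorm x ^+ 2 ;
  cnorm_complete : forall u : nat -> A,
    (forall e : R, 0 < e -> exists N, forall m n,
       (N <= m)%N -> (N <= n)%N -> cnorm (u m - u n) < e) ->
    exists l : A, cnorm (u n - l) @[n --> \oo] --> (0 : R)
}.

#[short(type="cstarType")]
HB.structure Definition CStar (R : realType) :=
  {A of GRing.Algebra R[i] A & isCStar R A}.

Section Algebras.
Variable R : realType.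
Implicit Types A B : cstarType R.

Definition cstar_cvg A (u : nat -> A) (l : A) : Prop :=
  cnorm (u n - l) @[n --> \oo] --> (0 : R).

Definition simple A : Prop := forall J : set A,
  (forall u l, (forall n, J (u n)) -> cstar_cvg u l -> J l) ->
  J 0 ->
  (forall x y, J x -> J y -> J (x + y)) ->
  (forall a x, J x -> J (a * x)) ->
  (forall a x, J x -> J (x * a)) ->
  J = [set 0] \/ J = setT.

Definition unital_embedding A B (i : B -> A) : Prop :=
  [/\ linear i, monoid_morphism i, {morph i : x / star x} & injective i].

Definition positive A (x : A) : Prop := exists y, x = star y * y.

Definition invertible A (x : A) : Prop := exists y, y * x = 1 /\ x * y = 1.

Definition spectrum A (x : A) : set R[i] := [set z | ~ invertible (x - z%:A)].

(* The scalar c such that x = c 1 (0 if x is not a scalar). *)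
Definition scalar_of A (x : A) : R[i] := xget 0 [set c | x = c%:A].

(* Continuous functional calculus f(h), for h self-adjoint and f continuous on
   the spectrum of h: the limit of the p_n(h), for any sequence of polynomials
   p_n converging to f uniformly on the spectrum. *)
Definition fun_calc A (f : R -> R) (h : A) : A :=
  xget 0 [set y | exists p : nat -> {poly R[i]},
    (forall e : R, 0 < e -> \forall n \near \oo,
       forall z, spectrum h z -> `|(p n).[z] - (f (complex.Re z))%:C| <= e%:C) /\
    cstar_cvg (fun n => horner_alg h (p n)) y].

Definition eta (t : R) : R := if 0 < t then - (t * ln t) else 0.

Definition entropy A (tr : A -> R[i]) (h : A) : R[i] := tr (fun_calc eta h).

End Algebras.

Section Expectations.
Variables (R : realType) (A B : cstarType R).
Implicit Types (i : B -> A) (E : A -> B).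

Definition cond_exp i E : Prop :=
  [/\ linear E,
      forall b, E (i b) = b,
      forall b a b', E (i b * a * i b') = b * E a * b'
    & forall a, positive (E (star a * a))].

Definition quasi_basis i E (s : seq A) : Prop :=
  forall x, x = \sum_(l <- s) l * i (E (star l * x)).

Definition index_finite i E : Prop :=
  cond_exp i E /\ exists s, quasi_basis i E s.

(* The Watatani index does not depend on the quasi-basis. *)
Definition Ind i E : A :=
  xget 0 [set x | exists2 s, quasi_basis i E s & x = \sum_(l <- s) l * star l].

(* Ind i E as a real number, when it is a scalar (e.g. for A simple). *)
Definition windex i E : R := xget 0 [set r | Ind i E = r%:C%:A].

Definition minimal_exp i E : Prop :=
  index_finite i E /\
  forall E', index_finite i E' -> windex i E <= windex i E'.

(* Adjointable operators on the right Hilbert B-module A, whose inner product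
   is <x, y> = E (x^* y). *)
Definition adjointable i E (T : A -> A) : Prop :=
  [/\ linear T,
      forall x b, T (x * i b) = T x * i b
    & exists S : A -> A, forall x y, E (star (T x) * y) = E (star x * S y)].

(* The C*-basic construction: a C*-algebra together with a *-isomorphism bc_op
   onto the *-algebra of adjointable operators. This determines it up to
   isomorphism, the norm included, since a C*-norm is unique. *)
Record basic_construction i E := BasicConstruction {
  bc_alg :> cstarType R ;
  bc_op : bc_alg -> A -> A ;
  bc_op_inj : forall s t, bc_op s =1 bc_op t -> s = t ;
  bc_op_onto : forall T, adjointable i E T <-> exists t, bc_op t =1 T ;
  bc_op_linear : forall c s t x,
    bc_op (c *: s + t) x = c *: bc_op s x + bc_op t x ;
  bc_op1 : forall x, bc_op 1 x = x ;
  bc_opM : forall s t x, bc_op (s * t) x = bc_op s (bc_op t x) ;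
  bc_op_star : forall t x y,
    E (star (bc_op t x) * y) = E (star x * bc_op (star t) y)
}.

(* The element of the basic construction given by an adjointable operator. *)
Definition bc_elt i E (A1 : basic_construction i E) (T : A -> A) : A1 :=
  xget 0 [set t | bc_op t =1 T].

Definition bc_incl i E (A1 : basic_construction i E) (a : A) : A1 :=
  bc_elt A1 (fun x => a * x).

Definition jones i E (A1 : basic_construction i E) : A1 :=
  bc_elt A1 (fun x => i (E x)).

End Expectations.

Section Tower.
Variables (R : realType) (A B : cstarType R) (i : B -> A) (E : A -> B).
Variables (A1 : basic_construction i E) (E1 : A1 -> A).
Variable (A2 : basic_construction (bc_incl A1) E1).
Variable (E2 : A2 -> A1).

Definition tr1 (x : A1) : R[i] := scalar_of (E (E1 x)).

Definition tr2 (y : A2) : R[i] := scalar_of (E (E1 (E2 y))).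

(* The trace-preserving conditional expectation of B' :&: A2 onto A' :&: A2,
   computed with a quasi-basis s of E. *)
Definition commutant_exp (s : seq A) (y : A2) : A2 :=
  (windex i E)^-1%:C *:
    \sum_(l <- s) bc_incl A2 (bc_incl A1 l) * y * bc_incl A2 (bc_incl A1 (star l)).

(* delta ^ 3 E(x e2 e1), where delta ^ 2 = [A : B]_0. *)
Definition fourier (s : seq A) (x : A1) : A2 :=
  (Num.sqrt (windex i E) ^+ 3)%:C *:
    commutant_exp s (bc_incl A2 x * jones A2 * bc_incl A2 (jones A1)).

End Tower.

(* Main.v *)
Require Import Defs.
From mathcomp Require Import all_boot all_order all_algebra.
From mathcomp Require Import all_classical all_reals all_analysis.
From mathcomp Require Import complex.
From mathcomp Require Import ring lra.
From Stdlib Require Ncring Ncring_tac.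

(* The commuting square condition says that Theta is the Jones projection e_1,
   so |Theta|^2 = e_1 has spectrum in {0, 1}, where eta vanishes. For the
   Fourier transform one needs e_1 e_2 e_1 = [A:B]_0^-1 e_1, i.e.
   E_1(e_1) = [A:B]_0^-1 for the minimal expectation E_1 : A_1 -> A; then
   F(e_1) = delta^-1, because the sum of the lambda_i e_1 lambda_i^* is 1.

   Put h = E_1(e_1), which lies in B' /\ A. Comparing the index of a minimal
   expectation E with that of x |-> E(g^* x g), for g = c (1 + t k) and k in the
   relative commutant, the vanishing of the first-order term in t yields
   sum_i lambda_i x lambda_i^* = Ind(E) E(x) for x in the relative commutant.
   Applying this to E and to E_1 (evaluated on right multiplications by elements
   of B' /\ A) shows that h^-1 is a scalar multiple of h; as E_1(x^* e_1 x) is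
   positive, h itself is a scalar, and the normalization sum lambda_i h
   lambda_i^* = 1 gives its value.

   The only facts needed about simple C^*-algebras are that their centers are
   trivial and that w^* w = r 1 forces r >= 0. *)

Set Implicit Arguments.
Unset Strict Implicit.
Unset Printing Implicit Defensive.

Import Order.TTheory GRing.Theory Num.Theory.
Import numFieldNormedType.Exports.

Local Open Scope classical_set_scope.
Local Open Scope complex_scope.
Local Open Scope ring_scope.

(** * C*-algebras *)

(** Together with [cstar_ring], this lets [non_commutative_ring] prove polynomial identities in a
    C*-algebra. *)
#[local] Instance cstar_ring_ops (R : realType) (A : cstarType R) :
  @Ncring.Ring_ops A 0 1 +%R *%R (fun x y => x - y) -%R eq := {}.

#[local] Instance cstar_ring (R : realType) (A : cstarType R) :
  Ncring.Ring (Ro := cstar_ring_ops A).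
Proof.
split; try exact _.
- exact: add0r.
- exact: addrC.
- exact: addrA.
- exact: mul1r.
- exact: mulr1.
- exact: mulrA.
- exact: mulrDl.
- by move=> x y z; exact: mulrDr.
- by [].
- exact: subrr.
Qed.

Section CStarTheory.
Variables (R : realType) (A : cstarType R).
Implicit Types (x y z a b : A) (c : R[i]) (r : R).

Lemma conjE c : c^* = conjc c. Proof. by []. Qed.

Lemma conj_i : ('i%C : R[i])^* = - 'i%C.
Proof. by apply/eqP; rewrite conjE eq_complex /= oppr0 !eqxx. Qed.

Lemma conj_real r : (r%:C)^* = r%:C :> R[i].
Proof. exact: conjc_real. Qed.

Lemma star0 : star (0 : A) = 0.
Proof. by have := starZ 0 (0 : A); rewrite rmorph0 !scale0r. Qed.

Lemma star1 : star (1 : A) = 1.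
Proof. by rewrite -[LHS]mul1r -{1}(starK 1) -starM mul1r starK. Qed.

Lemma starN x : star (- x) = - star x.
Proof. by apply/eqP; rewrite -subr_eq0 opprK -starD addNr star0. Qed.

Lemma starB x y : star (x - y) = star x - star y.
Proof. by rewrite starD starN. Qed.

Lemma starZr r x : star (r%:C *: x) = r%:C *: star x.
Proof. by rewrite starZ conj_real. Qed.

Lemma starA c : star (c%:A : A) = c^*%:A.
Proof. by rewrite starZ star1. Qed.

Lemma star_sum I (s : seq I) (f : I -> A) :
  star (\sum_(i <- s) f i) = \sum_(i <- s) star (f i).
Proof. by apply: (big_morph _ starD star0). Qed.

Lemma cnormZr r x : cnorm (r%:C *: x) = `|r| * cnorm x.
Proof.
apply: complexI; rewrite cnormZ normc_def /= expr0n addr0 sqrtr_sqr.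
by rewrite rmorphM.
Qed.

Lemma cnormZi x : cnorm ('i%C *: x) = cnorm x.
Proof.
apply: complexI; rewrite cnormZ normc_def /= expr0n expr1n add0r sqrtr1.
by rewrite mul1r.
Qed.

Lemma cnorm0 : cnorm (0 : A) = 0.
Proof. by rewrite -(scale0r 0) -[0]/(0%:C) cnormZr normr0 mul0r. Qed.

Lemma cnormN x : cnorm (- x) = cnorm x.
Proof.
have -> : - x = (-1)%:C *: x by rewrite rmorphN rmorph1 scaleN1r.
by rewrite cnormZr normrN1 mul1r.
Qed.

Lemma cnorm_ge0 x : 0 <= cnorm x.
Proof.
have := cnormD x (- x); rewrite subrr cnorm0 cnormN.
lra.
Qed.
Hint Resolve cnorm_ge0 : core.

Lemma cnormB x y : cnorm (x - y) <= cnorm x + cnorm y.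
Proof. by rewrite -[leRHS](congr1 _ (cnormN y)) cnormD. Qed.

Lemma cnorm_gt0 x : x <> 0 -> 0 < cnorm x.
Proof.
move=> x0; rewrite lt_neqAle cnorm_ge0 andbT; apply/eqP => h.
exact/x0/cnorm_eq0.
Qed.

Lemma cnorm_adj x : cnorm (star x) = cnorm x.
Proof.
have le_adj y : cnorm y <= cnorm (star y).
  have [->|/eqP/cnorm_gt0 y0] := eqVneq y 0; first by rewrite star0.
  by rewrite -(ler_pM2r y0) -expr2 -cnorm_star cnormM.
by apply/eqP; rewrite eq_le le_adj -{2}(starK x) le_adj.
Qed.

Lemma cnorm1 : cnorm (1 : A) = 1.
Proof.
have n0 : cnorm (1 : A) != 0.
  by apply/eqP => /cnorm_eq0/eqP; rewrite oner_eq0.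
by apply: (mulfI n0); rewrite mulr1 -expr2 -cnorm_star star1 mul1r.
Qed.

Lemma cnormAr r : cnorm (r%:C%:A : A) = `|r|.
Proof. by rewrite cnormZr cnorm1 mulr1. Qed.

Lemma cnorm_sum I (s : seq I) (f : I -> A) :
  cnorm (\sum_(i <- s) f i) <= \sum_(i <- s) cnorm (f i).
Proof.
elim/big_ind2: _ => [|u1 v1 u2 v2 h1 h2|//]; first by rewrite cnorm0.
exact: le_trans (cnormD _ _) (lerD h1 h2).
Qed.

Lemma star_sqr_eq0 x : star x * x = 0 -> x = 0.
Proof.
move=> h; apply: cnorm_eq0; apply/eqP.
by rewrite -sqrf_eq0 -cnorm_star h cnorm0.
Qed.

Lemma scalar_inj : injective (fun c : R[i] => c%:A : A).
Proof.
move=> c d /= /eqP; rewrite -subr_eq0 -scalerBl scaler_eq0 oner_eq0 orbF.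
by rewrite subr_eq0 => /eqP.
Qed.

Lemma cstar_cvg_unique (u : nat -> A) (x y : A) :
  cstar_cvg u x -> cstar_cvg u y -> x = y.
Proof.
move=> hx hy; apply/eqP; rewrite -subr_eq0; apply/eqP/cnorm_eq0.
apply/eqP; rewrite eq_le cnorm_ge0 andbT.
have h : cnorm (u n - y) + cnorm (u n - x) @[n --> \oo] --> (0 : R).
  by rewrite -[X in _ --> X](addr0 0); apply: cvgD.
have h0 : cnorm (x - y) @[n --> \oo] --> cnorm (x - y) by exact: cvg_cst.
apply: (ler_cvg_to h0 h); exists 0%N => // n _ /=.
have -> : x - y = (u n - y) - (u n - x) by Ncring_tac.non_commutative_ring.
exact: cnormB.
Qed.

Lemma cstar_cvg_le (u : nat -> A) (l : A) (v : nat -> R) :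
  (forall n, cnorm (u n - l) <= v n) -> v n @[n --> \oo] --> 0 ->
  cstar_cvg u l.
Proof.
move=> uv v0; rewrite /cstar_cvg.
apply: (squeeze_cvgr (f := fun=> 0) _ _ v0); last exact: cvg_cst.
by exists 0%N => // n _ /=; rewrite cnorm_ge0 uv.
Qed.

(** Telescoping against a geometric series shows that [u] is Cauchy. *)
Lemma cnorm_geometric_cvg (u : nat -> A) (M : R) :
  (forall n, cnorm (u n.+1 - u n) <= M * (2^-1) ^+ n) ->
  exists l, cstar_cvg u l.
Proof.
move=> hu; apply: cnorm_complete => e e0.
(* The last factor is the sum of the [2^-j] for [j < k]. *)
have tail n k :
    cnorm (u (n + k)%N - u n) <= M * (2^-1) ^+ n * (2 - 2 * (2^-1) ^+ k).
  elim: k => [|k IH]; first by rewrite addn0 subrr cnorm0 expr0 mulr1 subrr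
    mulr0.
  have -> : u (n + k.+1)%N - u n =
      (u (n + k.+1)%N - u (n + k)%N) + (u (n + k)%N - u n).
    by rewrite addrA subrK.
  apply: le_trans (cnormD _ _) _; rewrite addnS.
  apply: le_trans (lerD (hu _) IH) _.
  rewrite exprD exprS; set p := _ ^+ n; set q := _ ^+ k.
  by rewrite le_eqVlt; apply/orP; left; apply/eqP; field.
have M0 : 0 <= M.
  by have := le_trans (cnorm_ge0 _) (hu 0%N); rewrite expr0 mulr1.
have [N hN] : exists N, M * (2^-1) ^+ N * 4 < e.
  have : (2^-1 : R) ^+ n @[n --> \oo] --> 0.
    by apply: cvg_expr; rewrite ger0_norm ?invr_ge0// invf_lt1// ltr1n.
  (* The added 1 keeps the denominator positive when [M = 0]. *)
  move/cvgrPdist_lt => /(_ (e / (4 * M + 1))) [|N _ /(_ N (leqnn N)) h].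
    by apply: divr_gt0 => //; lra.
  exists N; move: h; rewrite sub0r normrN ger0_norm ?exprn_ge0 ?invr_ge0//.
  set p := _ ^+ N; rewrite ltr_pdivlMr; last by lra.
  have : 0 <= p by rewrite exprn_ge0 ?invr_ge0.
  nra.
have small m : (N <= m)%N -> cnorm (u m - u N) < e / 2.
  move=> /subnKC <-; apply: le_lt_trans (tail _ _) _.
  have : 0 <= M * 2^-1 ^+ N by rewrite mulr_ge0 ?exprn_ge0 ?invr_ge0.
  have : 0 <= (2^-1 : R) ^+ (m - N) by rewrite exprn_ge0 ?invr_ge0.
  set p := _ ^+ (m - N); set q := M * _; move: hN; rewrite -/q; nra.
exists N => m n hm hn.
have -> : u m - u n = (u m - u N) - (u n - u N).
  by Ncring_tac.non_commutative_ring.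
by apply: le_lt_trans (cnormB _ _) _; have := small _ hm; have := small _ hn;
  lra.
Qed.

(** The partial sums [u] of the geometric series converge, and both products of [u n] with [1 - x]
    equal [1 - x ^+ n], which tends to 1. *)
Lemma neumann x : cnorm x <= 2^-1 -> invertible (1 - x).
Proof.
move=> hx; pose u n := \sum_(i < n) x ^+ i.
have uS n : u n.+1 = u n + x ^+ n by rewrite /u big_ord_recr.
have xn n : cnorm (x ^+ n) <= (2^-1) ^+ n.
  elim: n => [|n IH]; first by rewrite !expr0 cnorm1.
  by rewrite !exprS; apply: le_trans (cnormM _ _) _; apply: ler_pM.
have [l hl] : exists l, cstar_cvg u l.
  by apply: (@cnorm_geometric_cvg u 1) => n; rewrite uS addrC addKr mul1r.
have c0 : cstar_cvg (fun n => 1 - x ^+ n) 1.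
  have h : (2^-1 : R) ^+ n @[n --> \oo] --> 0.
    by apply: cvg_expr; rewrite ger0_norm ?invr_ge0// invf_lt1// ltr1n.
  apply: (cstar_cvg_le _ h) => n.
  by rewrite addrAC subrr sub0r cnormN.
have cM a b n :
    cnorm (a * u n * b - a * l * b) <= cnorm a * cnorm b * cnorm (u n - l).
  rewrite -mulrBl -mulrBr mulrAC.
  by apply: le_trans (cnormM _ _) _; rewrite ler_wpM2r// cnormM.
have cv a b : cstar_cvg (fun n => a * u n * b) (a * l * b).
  apply: (cstar_cvg_le (cM a b)).
  rewrite -[X in _ --> X](mulr0 (cnorm a * cnorm b)).
  by apply: cvgM => //; exact: cvg_cst.
have ul n : (1 - x) * u n = 1 - x ^+ n.
  by rewrite -[RHS]opprB subrX1 -mulNr opprB.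
have ur n : u n * (1 - x) = 1 - x ^+ n.
  elim: n => [|n IH]; first by rewrite /u big_ord0 mul0r expr0 subrr.
  by rewrite uS mulrDl IH mulrBr mulr1 -exprSr addrA subrK.
exists l; split; apply: (cstar_cvg_unique _ c0).
  have := cv 1 (1 - x); rewrite mul1r.
  by under eq_fun do rewrite mul1r ur.
have := cv (1 - x) 1; rewrite mulr1.
by under eq_fun do rewrite mulr1 ul.
Qed.

Lemma star_inv x y : star x = x -> y * x = 1 -> x * y = 1 -> star y = y.
Proof.
move=> sx yx xy; rewrite -[LHS]mul1r -yx -mulrA -{1}sx -starM yx star1.
by rewrite mulr1.
Qed.

Lemma comm_inv x y z : y * x = 1 -> x * y = 1 -> x * z = z * x -> y * z = z * y.
Proof.
by move=> yx xy xz; rewrite -[LHS]mulr1 -xy mulrA -(mulrA y) -xz mulrA yx mul1r.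
Qed.

Lemma half_double x : (2^-1)%:C *: (x + x) = x.
Proof.
rewrite scalerDr -scalerDl -rmorphD.
have -> : 2^-1 + 2^-1 = 1 :> R by lra.
by rewrite rmorph1 scale1r.
Qed.

Lemma cartesian x : exists a b, [/\ star a = a, star b = b, x = a + 'i%C *: b,
  a = (2^-1)%:C *: (x + star x) & b = (- 2^-1)%:C *: ('i%C *: (x - star x))].
Proof.
exists ((2^-1)%:C *: (x + star x)), ((- 2^-1)%:C *: ('i%C *: (x - star x))).
split=> //.
- by rewrite starZr starD starK addrC.
- rewrite starZr starZ conj_i starB starK scaleNr -scalerN.
  by rewrite opprB.
have -> : 'i%C *: ((- 2^-1)%:C *: ('i%C *: (x - star x))) =
    (2^-1)%:C *: (x - star x).
  rewrite !scalerA; congr (_ *: _).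
  by rewrite mulrAC -expr2 sqr_i mulN1r rmorphN opprK.
by rewrite -scalerDr addrACA subrr addr0 half_double.
Qed.

Section Selfadjoint.
Variables (a b : A).
Hypotheses (sa : star a = a) (sb : star b = b) (ab : a * b = b * a).

Lemma cnorm_cartesian : cnorm (a + 'i%C *: b) ^+ 2 = cnorm (a * a + b * b).
Proof.
rewrite -cnorm_star starD starZ sa sb; congr cnorm.
rewrite conj_i scaleNr; set y := 'i%C *: b.
have yy : y * y = - (b * b).
  by rewrite /y -scalerAl -scalerAr scalerA -expr2 sqr_i scaleN1r.
have ya : y * a = a * y by rewrite /y -scalerAl -scalerAr ab.
transitivity (a * a + (a * y - y * a) - y * y).
  by Ncring_tac.non_commutative_ring.
by rewrite ya yy subrr addr0 opprK.
Qed.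

Lemma cnorm_re : cnorm a <= cnorm (a + 'i%C *: b).
Proof.
have h : 2%:C *: a = (a + 'i%C *: b) + star (a + 'i%C *: b).
  rewrite starD starZ sa sb.
  rewrite conj_i scaleNr addrACA subrr addr0 -mulr2n -(scaler_nat 2 a).
  by rewrite -(rmorph_nat (real_complex R)).
have := cnormD (a + 'i%C *: b) (star (a + 'i%C *: b)).
rewrite -h cnormZr cnorm_adj gtr0_norm//; lra.
Qed.

(** This replaces monotonicity of the norm on positive elements: for commuting self-adjoint [a] and
    [b] the right side is the squared norm of [a + i b], whose real part is [a]. *)
Lemma cnorm_sum_sqr : cnorm a ^+ 2 <= cnorm (a * a + b * b).
Proof. by rewrite -cnorm_cartesian ler_pXn2r ?nnegrE// cnorm_re. Qed.

End Selfadjoint.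

(* 1 - 2 a^2 is the real part of p = 1 - 2 a^2 + 2 i a, and
   p^* p = 1 + 4 a^4. *)
Lemma cnorm_1B2sqr a : star a = a ->
  cnorm (1 - (a * a + a * a)) ^+ 2 <= 1 + 4 * cnorm a ^+ 4.
Proof.
move=> sa; set x := 1 - _.
have sx : star x = x by rewrite starB star1 starD !starM sa.
have s2 : star (a + a) = a + a by rewrite starD sa.
have xa : x * (a + a) = (a + a) * x by rewrite /x;
  Ncring_tac.non_commutative_ring.
apply: le_trans (cnorm_sum_sqr sx s2 xa) _.
have -> : x * x + (a + a) * (a + a) = 1 + 4%:C *: (a * a * (a * a)).
  rewrite -[4%:C]/((4%:R : R)%:C) rmorph_nat scaler_nat /x !mulrS mulr0n.
  by Ncring_tac.non_commutative_ring.
apply: le_trans (cnormD _ _) _;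
  rewrite cnorm1 lerD2l cnormZr gtr0_norm// ler_pM2l//.
apply: le_trans (cnormM _ _) _; rewrite [_ ^+ 4](exprM _ 2 2).
rewrite [leRHS]expr2.
by apply: ler_pM => //; apply: le_trans (cnormM _ _) _; rewrite expr2.
Qed.

Lemma i_sqr b : ('i%C *: b) * ('i%C *: b) = - (b * b).
Proof. by rewrite -scalerAl -scalerAr scalerA -expr2 sqr_i scaleN1r. Qed.

Lemma star_i b : star b = b -> star ('i%C *: b) = - ('i%C *: b).
Proof. by move=> sb; rewrite starZ conj_i sb scaleNr. Qed.

(* For u = a + i b, the element Z = 9 - u u^* = 4 (1 - a^2/2) + 4 (1 - b^2/2)
   has norm at most 4 sqrt 5 < 10, whereas Z u = 10 u. *)
Lemma star_sqr_neqN1 (u : A) : star u * u <> -1.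
Proof.
move=> uu.
have u1 : cnorm u = 1.
  have /eqP := cnorm_star u; rewrite uu cnormN cnorm1 eq_sym sqrf_eq1.
  by case/orP => /eqP // h; have := cnorm_ge0 u; rewrite h; lra.
have [a [b [sa sb ub _ _]]] := cartesian u.
have ca : cnorm a <= 1 by rewrite -u1 ub; apply: cnorm_re.
(* [b] is the real part of [- i u]. *)
have cb : cnorm b <= 1.
  have -> : 1 = cnorm (b + 'i%C *: (- a)).
    transitivity (cnorm u); first by [].
    rewrite -(cnormZi (b + _)) ub; congr cnorm.
    by rewrite scalerDr !scalerN scalerA -expr2 sqr_i scaleN1r opprK addrC.
  by apply: cnorm_re => //; rewrite starN sa.
(* Take [y = x / 2]; since its norm is at most 1/2, [cnorm_1B2sqr] gives the bound
   [1 + 4 / 16 = 5 / 4]. *)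
have half x : star x = x -> cnorm x <= 1 -> exists y,
    [/\ x = y + y, star y = y & cnorm (1 - (y * y + y * y)) ^+ 2 <= 5 / 4].
  move=> sx cx; exists ((2^-1)%:C *: x); split.
  - by rewrite -scalerDr half_double.
  - by rewrite starZr sx.
  have cy : cnorm ((2^-1)%:C *: x) <= 2^-1.
    by rewrite cnormZr ger0_norm ?invr_ge0//; lra.
  apply: le_trans (cnorm_1B2sqr _) _; first by rewrite starZr sx.
  have : cnorm ((2^-1)%:C *: x) ^+ 4 <= (2^-1) ^+ 4.
    by rewrite ler_pXn2r ?nnegrE ?invr_ge0.
  have -> : (2^-1 : R) ^+ 4 = 1 / 16 by field.
  by lra.
have [p [ap sp np]] := half _ sa ca; have [q [bq sq nq]] := half _ sb cb.
set P := 1 - _ in np; set Q := 1 - _ in nq.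
have bound (y : R) : 0 <= y -> y ^+ 2 <= 5 / 4 -> y < 5 / 4 by nra.
(* Strictness matters: four times this bound is exactly the factor 10 obtained below. *)
have nPQ : cnorm (P + Q) < 5 / 2.
  apply: le_lt_trans (cnormD _ _) _.
  by have := bound _ (cnorm_ge0 _) np; have := bound _ (cnorm_ge0 _) nq; lra.
have su : star u = a - 'i%C *: b by rewrite ub starD star_i// sa.
have Z : (P + Q) + (P + Q) + ((P + Q) + (P + Q)) =
  1 *+ 8 - (u * star u + star u * u).
  rewrite su ub; have := i_sqr b; set y := 'i%C *: b => yy.
  transitivity (1 *+ 8 - (a * a + a * a) + (y * y + y * y)).
    rewrite yy ap bq /P /Q !mulrS mulr0n; Ncring_tac.non_commutative_ring.
  by Ncring_tac.non_commutative_ring.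
have {}Z : (P + Q) *+ 4 * u = u *+ 10.
  have -> : (P + Q) *+ 4 = (P + Q) + (P + Q) + ((P + Q) + (P + Q)).
    by rewrite !mulrS mulr0n; Ncring_tac.non_commutative_ring.
  have uuu : u * star u * u = - u by rewrite -mulrA uu mulrN1.
  transitivity (1 *+ 8 * u - (u * star u * u - u)).
    by rewrite Z uu; Ncring_tac.non_commutative_ring.
  by rewrite uuu !mulrS !mulr0n; Ncring_tac.non_commutative_ring.
have nMn x n : cnorm (x *+ n) = n%:R * cnorm x.
  by rewrite -(scaler_nat n x) -(rmorph_nat (real_complex R)) cnormZr normr_nat.
have := cnormM ((P + Q) *+ 4) u.
by rewrite Z !nMn u1; lra.
Qed.

(** If [r < 0], dividing the square root [w] by [sqrt (- r)] gives an element excluded by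
    [star_sqr_neqN1]. *)
Lemma positive_ge0 r : positive (r%:C%:A : A) -> 0 <= r.
Proof.
move=> [w hw]; rewrite leNgt; apply/negP => r0.
apply: (@star_sqr_neqN1 (((Num.sqrt (- r))^-1)%:C *: w)).
rewrite starZr -scalerAl -scalerAr -hw !scalerA -!rmorphM.
have -> : (Num.sqrt (- r))^-1 * (Num.sqrt (- r))^-1 * r = -1.
  have h : Num.sqrt (- r) ^+ 2 = - r by rewrite sqr_sqrtr// oppr_ge0 ltW.
  have h0 : Num.sqrt (- r) != 0 by rewrite gt_eqF// sqrtr_gt0 oppr_gt0.
  by rewrite -invfM -expr2 h invrN mulNr mulVf// lt_eqF.
by rewrite rmorphN rmorph1 scaleN1r.
Qed.

(** * Centers of simple C*-algebras *)

Definition center z := forall x, x * z = z * x.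

Definition trivial_center := forall z, center z -> exists c, z = c%:A.

Lemma centerM x y : center x -> center y -> center (x * y).
Proof. by move=> cx cy z; rewrite mulrA cx -mulrA cy mulrA. Qed.

Lemma centerB x y : center x -> center y -> center (x - y).
Proof. by move=> cx cy z; rewrite mulrBr cx cy mulrBl. Qed.

Lemma centerD x y : center x -> center y -> center (x + y).
Proof. by move=> cx cy z; rewrite mulrDr cx cy mulrDl. Qed.

Lemma center1 : center 1.
Proof. by move=> z; rewrite mulr1 mul1r. Qed.

Lemma centerZ c x : center x -> center (c *: x).
Proof. by move=> cx z; rewrite -scalerAr cx scalerAl. Qed.

Lemma center_inv x y : center x -> y * x = 1 -> x * y = 1 -> center y.
Proof. by move=> cx yx xy z; rewrite (comm_inv yx xy (esym (cx z))). Qed.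

Lemma center_star x : center x -> center (star x).
Proof. by move=> cx z; rewrite -[z]starK -!starM cx. Qed.

(** As [z] is central, the closure of [z A] is a two-sided ideal, nonzero and hence everything. Some
    [z * a] then lies within 1/2 of 1 and is invertible by the Neumann series. *)
Lemma simple_center_inv : simple A ->
  forall z, center z -> z <> 0 -> invertible z.
Proof.
move=> hA z cz z0.
(* The closure of [z A], described by approximation. *)
pose J := [set l : A | forall e : R, 0 < e -> exists a, cnorm (z * a - l) < e].
have Jz a : J (z * a).
  by move=> e e0; exists a; rewrite subrr cnorm0.
have mulJ x y l : J l -> J (x * l * y).
  move=> Jl e e0; have d0 : 0 < cnorm x * cnorm y + 1.
    by rewrite ltr_wpDl// mulr_ge0.
  have [a ha] := Jl (e / (cnorm x * cnorm y + 1)) (divr_gt0 e0 d0).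
  exists (x * a * y).
  have -> : z * (x * a * y) - x * l * y = x * (z * a - l) * y.
    by rewrite mulrBr mulrBl !mulrA -cz.
  apply: le_lt_trans (cnormM _ _) _.
  apply: le_lt_trans (ler_wpM2r (cnorm_ge0 _) (cnormM _ _)) _.
  move: ha; rewrite ltr_pdivlMr//.
  have := cnorm_ge0 (z * a - l).
  set q := cnorm (_ - _); move: (cnorm_ge0 x) (cnorm_ge0 y); nra.
have [] := hA J.
- move=> u l Ju /cvgrPdist_lt ul e e0.
  have [N _ /(_ N (leqnn N))] := ul (e / 2) (divr_gt0 e0 (ltr0n _ 2)).
  rewrite sub0r normrN ger0_norm// => hN.
  have [a ha] := Ju N (e / 2) (divr_gt0 e0 (ltr0n _ 2)).
  exists a; have -> : z * a - l = (z * a - u N) + (u N - l).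
    by Ncring_tac.non_commutative_ring.
  by apply: le_lt_trans (cnormD _ _) _; lra.
- by rewrite -(mulr0 z).
- move=> x y Jx Jy e e0.
  have [a ha] := Jx (e / 2) (divr_gt0 e0 (ltr0n _ 2)).
  have [b hb] := Jy (e / 2) (divr_gt0 e0 (ltr0n _ 2)).
  exists (a + b); have -> : z * (a + b) - (x + y) = (z * a - x) + (z * b - y).
    by Ncring_tac.non_commutative_ring.
  by apply: le_lt_trans (cnormD _ _) _; lra.
- by move=> a x Jx; rewrite -[_ * _]mulr1; exact: mulJ.
- by move=> a x Jx; rewrite -[x]mul1r; exact: mulJ.
- by move=> J0; case: z0; have := Jz 1; rewrite J0 mulr1.
move=> JT; have J1 : J 1 by rewrite JT.
have [a ha] : exists a, cnorm (z * a - 1) < 2^-1 by apply: J1; lra.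
have [] := @neumann (1 - z * a); first by rewrite -opprB cnormN ltW.
rewrite opprB addrC subrK => y [yz zy].
by exists (a * y); rewrite cz mulrA zy.
Qed.

(** The rational parametrization of the circle: with [I] the inverse of [1 + s^2], the elements
    [p = 2 s I] and [q = (1 - s^2) I] satisfy [p^2 + q^2 = 1], so [cnorm_sum_sqr] bounds [p] by
    1. *)
Lemma norm_half (s I : A) : star s = s -> star I = I -> s * I = I * s ->
  (1 + s * s) * I = 1 -> cnorm (s * I) <= 2^-1.
Proof.
move=> ss sI sIc hI.
pose p := s * I + s * I; pose q := (1 - s * s) * I.
have sp : star p = p by rewrite /p starD starM sI ss -sIc.
have cI : s * s * I = I * (s * s) by rewrite -mulrA sIc mulrA sIc mulrA.
have sq : star q = q.
  by rewrite /q starM starB starM ss sI star1 mulrBr mulr1 -cI mulrBl mul1r.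
have sI2 : s * I * (s * I) = s * s * (I * I).
  by rewrite -mulrA (mulrA I) -sIc !mulrA.
have pq : p * q = q * p.
  have com x : GRing.comm x s -> GRing.comm x I -> GRing.comm x q.
    by move=> xs xI; apply/commrM => //; apply/commrB/commrM => //;
      exact: commr1.
  have comsI : GRing.comm (s * I) q.
    by apply/commr_sym/commrM; apply/commr_sym/com => //; exact: esym.
  exact/commr_sym/commrD/commr_sym.
have h : p * p + q * q = 1.
  have -> : q * q = (1 - s * s) * (1 - s * s) * (I * I).
    rewrite /q -!mulrA; congr (_ * _); rewrite !mulrA; congr (_ * _).
    by rewrite mulrBl mulrBr mul1r mulr1 cI.
  have -> : p * p = (s * s + s * s + (s * s + s * s)) * (I * I).
    by rewrite /p mulrDl !mulrDr sI2 !mulrDl.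
  transitivity ((1 + s * s) * ((1 + s * s) * I) * I); last by rewrite hI mulr1.
  by Ncring_tac.non_commutative_ring.
have := cnorm_sum_sqr sp sq pq; rewrite h cnorm1.
have -> : cnorm p = 2 * cnorm (s * I).
  rewrite /p -mulr2n -(scaler_nat 2 (s * I)) -(rmorph_nat (real_complex R))
    cnormZr.
  by rewrite normr_nat.
by have := cnorm_ge0 (s * I); nra.
Qed.

(* An elementary substitute for the Gelfand-Mazur theorem: from the inverse of
   1 - s^2 one gets X = s^2 / (1 - s^2), and passing from s to s^2 at least
   halves the norm of X while keeping it above 1/2. *)
Lemma center_norm1 : simple A -> forall h, center h -> star h = h ->
  cnorm h = 1 -> h * h = 1.
Proof.
move=> hA h ch sh h1; apply: contrapT => hh.
(* Induction on [n], replacing [s] by [s^2] and [X] by [X s^2 / (1 + s^2)]. At [n = 0],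
   [X (1 - s^2)] has norm 1 while [1 - s^2] has norm at most 2. *)
have key n : forall s X, center s -> star s = s -> cnorm s = 1 ->
    X * (1 - s * s) = s * s -> 2 ^+ n <= 2 * cnorm X.
  elim: n => [|n IH] s X cs ss s1 hX.
    have n1 : cnorm (X * (1 - s * s)) = 1.
      by rewrite hX -{1}ss cnorm_star s1 expr1n.
    have := cnormM X (1 - s * s); rewrite n1.
    have := cnormB 1 (s * s); rewrite cnorm1.
    have := cnormM s s; rewrite s1 mulr1 expr0.
    by have := cnorm_ge0 X; nra.
  have cD : center (1 + s * s) by apply: centerD center1 (centerM cs cs).
  have sD : star (1 + s * s) = 1 + s * s by rewrite starD star1 starM ss.
  (* This central element is nonzero: by [cnorm_sum_sqr] its norm is at least that of 1. *)
  have [I [Il Ir]] : invertible (1 + s * s).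
    apply: simple_center_inv => // D0.
    have := @cnorm_sum_sqr 1 s star1 ss; rewrite !mul1r mulr1 => /(_ erefl).
    by rewrite D0 cnorm0 cnorm1 expr1n; lra.
  have cI := center_inv cD Il Ir.
  have nI : cnorm (s * I) <= 2^-1.
    by apply: norm_half => //; exact: star_inv sD Il Ir.
  have nX : cnorm (X * s * (s * I)) <= 2^-1 * cnorm X.
    apply: le_trans (cnormM _ _) _; rewrite mulrC.
    apply: ler_pM => //; apply: le_trans (cnormM _ _) _.
    by rewrite s1 mulr1.
  have ns : cnorm (s * s) = 1.
    by rewrite -{1}ss cnorm_star s1 expr1n.
  have := IH (s * s) (X * s * (s * I)) (centerM cs cs).
  rewrite starM ss ns => /(_ erefl erefl).
  have -> : X * s * (s * I) * (1 - s * s * (s * s)) = s * s * (s * s).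
    transitivity (X * (s * s) * (I * (1 + s * s)) * (1 - s * s)).
      by Ncring_tac.non_commutative_ring.
    by rewrite Il mulr1 (centerM cs cs X) -(mulrA (s * s) X) hX.
  by move=> /(_ erefl); rewrite exprS; lra.
have cD : center (1 - h * h) by apply: centerB center1 (centerM ch ch).
have [Y [Yl _]] : invertible (1 - h * h).
  by apply: simple_center_inv => // /eqP; rewrite subr_eq0 => /eqP/esym.
pose X := h * h * Y.
have hX : X * (1 - h * h) = h * h by rewrite /X -mulrA Yl mulr1.
(* The norm of the fixed [X] cannot exceed [2 ^+ n / 2] for every [n]. *)
have [n hn] : exists n : nat, 2 * cnorm X < n%:R.
  by exists (Num.bound (2 * cnorm X)); rewrite archi_boundP// mulr_ge0.
have := key n h X ch sh h1 hX.
have : n%:R <= 2 ^+ n :> R by rewrite -natrX ler_nat ltnW// ltn_expl.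
by lra.
Qed.

(** A self-adjoint central [k] of norm 1 has [(1 - k) (1 + k) = 0], and [1 - k] is zero or
    invertible, so [k] is 1 or -1. The general case splits into real and imaginary parts. *)
Lemma simple_trivial_center : simple A -> trivial_center.
Proof.
move=> hA z cz.
have real_case h : center h -> star h = h -> exists c, h = c%:A.
  move=> ch sh; have [->|/eqP h0] := eqVneq h 0; first by exists 0;
    rewrite scale0r.
  have n0 := cnorm_gt0 h0.
  pose k := ((cnorm h)^-1)%:C *: h.
  have ck : center k by exact: centerZ.
  have sk : star k = k by rewrite starZr sh.
  have nk : cnorm k = 1 by rewrite cnormZr gtr0_norm ?invr_gt0// mulVf// gt_eqF.
  have hk : h = (cnorm h)%:C *: k.
    by rewrite scalerA -rmorphM mulfV ?gt_eqF// rmorph1 scale1r.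
  have kk := center_norm1 hA ck sk nk.
  have [k1|k1] := pselect (1 - k = 0).
    by exists (cnorm h)%:C; rewrite {1}hk -(subr0_eq k1).
  have [y [y1 _]] := simple_center_inv hA (centerB center1 ck) k1.
  exists (- (cnorm h)%:C); rewrite {1}hk scaleNr -scalerN; congr (_ *: _).
  apply/eqP; rewrite -addr_eq0 addrC; apply/eqP.
  have k0 : (1 - k) * (1 + k) = 0.
    transitivity (1 - k * k); first by Ncring_tac.non_commutative_ring.
    by rewrite kk subrr.
  transitivity (y * (1 - k) * (1 + k)); first by rewrite y1 mul1r.
  by rewrite -mulrA k0 mulr0.
have [a [b [sa sb zab az bz]]] := cartesian z.
have ca : center a by rewrite az; apply/centerZ/centerD/center_star.
have cb : center b by rewrite bz; apply/centerZ/centerZ/centerB/center_star.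
have [c1 a1] := real_case _ ca sa; have [c2 b2] := real_case _ cb sb.
by exists (c1 + 'i%C * c2); rewrite zab a1 b2 scalerA -scalerDl.
Qed.

End CStarTheory.

(** * Continuous functional calculus at scalars and at idempotents *)

Section FunctionalCalculus.
Variables (R : realType) (A : cstarType R) (f : R -> R).
Implicit Types (h p : A) (c : R).

Lemma horner_alg_poly_ind h (g : {poly R[i]} -> A) :
  g 0 = 0 -> (forall q (c : R[i]), g (q * 'X + c%:P) = g q * h + c%:A) ->
  forall q, horner_alg h q = g q.
Proof.
move=> g0 gS; elim/poly_ind => [|q c IH]; first by rewrite g0 rmorph0.
by rewrite gS rmorphD rmorphM /= IH horner_algX horner_algC.
Qed.

Lemma horner_alg_scalar (c : R[i]) q : horner_alg (c%:A : A) q = (q.[c])%:A.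
Proof.
apply: (horner_alg_poly_ind (g := fun q => (q.[c])%:A)) => [|{}q d].
  by rewrite horner0 scale0r.
by rewrite hornerMXaddC scalerDl -scalerAr mulr1 scalerA mulrC.
Qed.

Lemma horner_alg_idem p q : p * p = p ->
  horner_alg p q = q.[0] *: (1 - p) + q.[1] *: p.
Proof.
move=> pp.
apply: (horner_alg_poly_ind (g := fun q => q.[0] *: (1 - p) + q.[1] *: p)).
  by rewrite !horner0 !scale0r addr0.
move=> {}q c; rewrite !hornerMXaddC mulr0 add0r mulr1 scalerDl.
rewrite mulrDl -!scalerAl mulrBl mul1r pp subrr scaler0 add0r.
by rewrite addrCA -scalerDr subrK.
Qed.

Lemma cnorm_scale (a : R[i]) h e : `|a| <= e%:C ->
  cnorm (a *: h) <= e * cnorm h.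
Proof.
move=> ae; rewrite -lecR cnormZ rmorphM ler_wpM2r//.
by rewrite ler0c cnorm_ge0.
Qed.

(** The first premise keeps [xget] from its default value; the second forces every admissible
    approximating sequence to have the limit [y]. *)
Lemma fun_calc_eq h y :
  (exists p : nat -> {poly R[i]},
    (forall e : R, 0 < e -> \forall n \near \oo,
       forall z, spectrum h z ->
       `|(p n).[z] - (f (complex.Re z))%:C| <= e%:C) /\
    cstar_cvg (fun n => horner_alg h (p n)) y) ->
  (forall p : nat -> {poly R[i]},
    (forall e : R, 0 < e -> \forall n \near \oo,
       forall z, spectrum h z ->
       `|(p n).[z] - (f (complex.Re z))%:C| <= e%:C) ->
    exists M, forall e : R, 0 < e -> \forall n \near \oo,
       cnorm (horner_alg h (p n) - y) <= e * M) ->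
  fun_calc f h = y.
Proof.
move=> hy uy; rewrite /fun_calc; case: xgetP => [z -> [p [pf pz]]|/(_ y)//].
apply: (cstar_cvg_unique pz).
have [M hM] := uy p pf.
apply/cvgrPdist_le => e e0.
have d0 : 0 < e / (`|M| + 1) by apply: divr_gt0 => //; have := normr_ge0 M; lra.
have := hM _ d0; apply: filterS => n hn.
rewrite sub0r normrN ger0_norm ?cnorm_ge0//; apply: le_trans hn _.
rewrite mulrAC ler_pdivrMr; last by have := normr_ge0 M; lra.
by rewrite ler_pM2l//; have := ler_norm M; lra.
Qed.

Lemma fun_calc_scalar c : fun_calc f (c%:C%:A : A) = (f c)%:C%:A.
Proof.
have cs : spectrum (c%:C%:A : A) c%:C.
  move=> [y [/eqP]]; rewrite subrr mulr0 eq_sym oner_eq0//.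
apply: fun_calc_eq.
  exists (fun=> (f c)%:C%:P); split.
    move=> e e0; apply: nearW => n z hz.
    have -> : z = c%:C.
      apply: contrapT => zc; apply: hz.
      have zc0 : c%:C - z != 0 by rewrite subr_eq0; apply/eqP => /esym.
      exists ((c%:C - z)^-1%:A); rewrite -scalerBl -!scalerAl !mul1r !scalerA.
      by rewrite mulVf// mulfV// scale1r.
    by rewrite hornerC /= subrr normr0 ler0c ltW.
  rewrite /cstar_cvg; under eq_fun do rewrite horner_algC subrr cnorm0.
  exact: cvg_cst.
move=> p hp; exists 1 => e e0; have := hp e e0; apply: filterS => n /(_ _ cs) h.
by rewrite horner_alg_scalar -scalerBl -(cnorm1 A); exact: cnorm_scale.
Qed.

Lemma fun_calc_idem p : p * p = p -> f 0 = 0 -> f 1 = 0 -> fun_calc f p = 0.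
Proof.
move=> pp f0 f1; apply: fun_calc_eq.
  exists (fun=> 0); split; last first.
    rewrite /cstar_cvg; under eq_fun do rewrite rmorph0 subrr cnorm0.
    exact: cvg_cst.
  move=> e e0; apply: nearW => n z hz; rewrite horner0 sub0r normrN.
  suff -> : f (complex.Re z) = 0 by rewrite normr0 ler0c ltW.
  have [->//|z0] := eqVneq z 0; have [->//|z1] := eqVneq z 1.
  (* For [z] other than 0 and 1, [p^2 = p] gives [(p - z) (p - 1 + z) = z (1 - z)]. *)
  case: hz; exists ((z * (1 - z))^-1 *: (p - 1 + z%:A)).
  have h0 : z * (1 - z) != 0 by rewrite mulf_neq0// subr_eq0 eq_sym.
  have zc : z%:A * p = p * z%:A by rewrite -scalerAl -scalerAr mul1r mulr1.
  have e1 : (p - z%:A) * (p - 1 + z%:A) = (z * (1 - z))%:A.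
    transitivity (p * p - p + (p * z%:A - z%:A * p) + (z%:A - z%:A * z%:A)).
      by Ncring_tac.non_commutative_ring.
    by rewrite pp zc !subrr !add0r -scalerAl mul1r scalerA -scalerBl mulrBr
      mulr1.
  have e2 : (p - 1 + z%:A) * (p - z%:A) = (z * (1 - z))%:A.
    transitivity (p * p - p + (z%:A * p - p * z%:A) + (z%:A - z%:A * z%:A)).
      by Ncring_tac.non_commutative_ring.
    by rewrite pp zc !subrr !add0r -scalerAl mul1r scalerA -scalerBl mulrBr
      mulr1.
  by rewrite -scalerAl -scalerAr e1 e2 scalerA mulVf// scale1r.
move=> q hq; exists (cnorm (1 - p) + cnorm p) => e e0.
have := hq e e0; apply: filterS => n hn.
rewrite subr0 horner_alg_idem// mulrDr.
apply: le_trans (cnormD _ _) (lerD _ _).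
  (* The polynomials are controlled only on the spectrum. If 0 is not in it, [p] is invertible, so
     [p = 1] and this term vanishes; likewise below, [p = 0] if 1 is not in it. *)
  have [s0|/contrapT[y [_ py]]] := pselect (spectrum p 0).
    by apply: cnorm_scale; have := hn _ s0; rewrite /= f0 subr0.
  rewrite scale0r subr0 in py.
  have -> : p = 1 by rewrite -[LHS]mulr1 -py mulrA pp.
  by rewrite subrr scaler0 cnorm0 mulr0.
have [s1|/contrapT[y [_ py]]] := pselect (spectrum p 1).
  by apply: cnorm_scale; have := hn _ s1; rewrite /= f1 subr0.
rewrite scale1r in py.
have -> : p = 0.
  by rewrite -[LHS]mulr1 -py mulrA mulrBr pp mulr1 subrr mul0r.
by rewrite scaler0 cnorm0 mulr0.
Qed.

End FunctionalCalculus.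

(** * Conditional expectations of index-finite type *)

Section LinearMaps.
Variables (K : pzRingType) (U V : lmodType K) (f : U -> V).
Hypothesis hf : linear f.

Lemma lin0 : f 0 = 0.
Proof. by have := hf (-1) 0 0; rewrite addr0 scaler0 scaleN1r addNr. Qed.

Lemma linD : {morph f : x y / x + y}.
Proof. by move=> x y; have := hf 1 x y; rewrite !scale1r. Qed.

Lemma linZ c x : f (c *: x) = c *: f x.
Proof. by have := hf c x 0; rewrite !addr0 lin0 addr0. Qed.

Lemma linN x : f (- x) = - f x.
Proof. by rewrite -scaleN1r linZ scaleN1r. Qed.

Lemma linB x y : f (x - y) = f x - f y.
Proof. by rewrite linD linN. Qed.

Lemma lin_sum I (s : seq I) (g : I -> U) :
  f (\sum_(j <- s) g j) = \sum_(j <- s) f (g j).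
Proof. exact: (big_morph f linD lin0). Qed.

End LinearMaps.

Lemma scalar_selfadjoint (R : realType) (A : cstarType R) (c : R[i]) :
  star (c%:A : A) = c%:A -> c = (complex.Re c)%:C.
Proof.
rewrite starA => /scalar_inj.
by case: c => p q; rewrite conjE => -[] /eqP; rewrite eqNr => /eqP ->.
Qed.

Section Expectation.
Variables (R : realType) (A B : cstarType R) (i : B -> A) (E : A -> B).
Hypotheses (hi : unital_embedding i) (hE : cond_exp i E).
Implicit Types (x y z k : A) (b : B) (s : seq A) (c : R[i]) (r : R).

Let i_lin : linear i. Proof. by case: hi. Qed.
Let E_lin : linear E. Proof. by case: hE. Qed.

Lemma embM : {morph i : b b' / b * b'}. Proof. by case: hi => _ []. Qed.

Lemma emb1 : i 1 = 1. Proof. by case: hi => _ []. Qed.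

Lemma emb_star b : i (star b) = star (i b). Proof. by case: hi. Qed.

Lemma embA c : i c%:A = c%:A. Proof. by rewrite (linZ i_lin) emb1. Qed.

Lemma expK b : E (i b) = b. Proof. by case: hE. Qed.

Lemma expMl b x : E (i b * x) = b * E x.
Proof. by case: hE => _ _ h _; have := h b x 1; rewrite emb1 !mulr1. Qed.

Lemma expMr x b : E (x * i b) = E x * b.
Proof. by case: hE => _ _ h _; have := h 1 x b; rewrite emb1 !mul1r. Qed.

Lemma exp1 : E 1 = 1. Proof. by rewrite -emb1 expK. Qed.

Lemma expA c : E c%:A = c%:A. Proof. by rewrite (linZ E_lin) exp1. Qed.

Lemma exp_pos x : positive (E (star x * x)). Proof. by case: hE. Qed.

Lemma exp_star x : E (star x) = star (E x).
Proof.
have pos_sa y : star (E (star y * y)) = E (star y * y).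
  by have [w ->] := exp_pos y; rewrite starM starK.
(* Polarization writes [2 E y] as a difference of values of [E] at positive elements, which are
   self-adjoint. *)
have real y : star y = y -> star (E y) = E y.
  move=> sy; have h : E (star (1 + y) * (1 + y)) - E (star y * y) - 1 =
    E y + E y.
    rewrite -exp1 -!(linB E_lin) -(linD E_lin) starD star1 sy; congr E.
    by Ncring_tac.non_commutative_ring.
  have h2 : star (E y + E y) = E y + E y by rewrite -h !starB star1 !pos_sa.
  by rewrite -[E y]half_double starZr h2.
have [a [b [sa sb -> _ _]]] := cartesian x.
rewrite starD starZ sa sb !(linD E_lin) !(linZ E_lin) starD starZ.
by rewrite !real.
Qed.

Definition relcomm x := forall b, i b * x = x * i b.

Lemma relcommM x y : relcomm x -> relcomm y -> relcomm (x * y).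
Proof. by move=> cx cy b; rewrite mulrA cx -mulrA cy mulrA. Qed.

Lemma relcommD x y : relcomm x -> relcomm y -> relcomm (x + y).
Proof. by move=> cx cy b; rewrite mulrDr cx cy mulrDl. Qed.

Lemma relcommB x y : relcomm x -> relcomm y -> relcomm (x - y).
Proof. by move=> cx cy b; rewrite mulrBr cx cy mulrBl. Qed.

Lemma relcommZ c x : relcomm x -> relcomm (c *: x).
Proof. by move=> cx b; rewrite -scalerAr cx scalerAl. Qed.

Lemma relcomm1 : relcomm 1.
Proof. by move=> b; rewrite mulr1 mul1r. Qed.

Lemma relcomm_inv x y : relcomm x -> y * x = 1 -> x * y = 1 -> relcomm y.
Proof. by move=> cx yx xy b; rewrite (comm_inv yx xy (esym (cx b))). Qed.

Lemma relcomm_star x : relcomm x -> relcomm (star x).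
Proof. by move=> cx b; rewrite -[i b]starK -!starM -emb_star cx. Qed.

Lemma exp_relcomm x : relcomm x -> center (E x).
Proof. by move=> cx b; rewrite -expMl cx expMr. Qed.

(** For a quasi-basis [s], its value at 1 is the Watatani index. On the relative commutant it is
    independent of [s] and central-valued, by [phi_indep] and [phi_center]. *)
Definition phi s y := \sum_(l <- s) l * y * star l.

Lemma phiD s : {morph phi s : x y / x + y}.
Proof.
move=> x y; rewrite /phi -big_split; apply: eq_bigr => l _.
by rewrite mulrDr mulrDl.
Qed.

Lemma phiZ s c x : phi s (c *: x) = c *: phi s x.
Proof.
by rewrite /phi scaler_sumr; apply: eq_bigr => l _; rewrite -scalerAr -scalerAl.
Qed.

Lemma phi_star s x : star (phi s x) = phi s (star x).
Proof.
by rewrite /phi star_sum; apply: eq_bigr => l _; rewrite !starM starK mulrA.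
Qed.

Lemma phi_norm s x : cnorm (phi s x) <= (\sum_(l <- s) cnorm l ^+ 2) * cnorm x.
Proof.
apply: le_trans (cnorm_sum _ _) _; rewrite mulr_suml ler_sum// => l _.
apply: le_trans (cnormM _ _) _; rewrite cnorm_adj expr2 mulrAC.
by rewrite ler_wpM2r ?cnorm_ge0// cnormM.
Qed.

Lemma quasi_basis_adj s y : quasi_basis i E s ->
  y = \sum_(l <- s) i (E (y * l)) * star l.
Proof.
move=> qs; rewrite -[LHS]starK {1}(qs (star y)) star_sum; apply: eq_bigr => l _.
by rewrite starM -emb_star -exp_star starM !starK.
Qed.

(** Expand [u j] along [s], move the coefficients from [B] past [x], and resum the expansion of
    [star l]. General dual pairs are allowed because [dual_jones_eq] uses one that is not of the
    form [l], [star l]. *)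
Lemma phi_swap s I (t : seq I) (u v : I -> A) x :
  quasi_basis i E s -> relcomm x ->
  (forall y, y = \sum_(j <- t) i (E (y * u j)) * v j) ->
  \sum_(j <- t) u j * x * v j = phi s x.
Proof.
move=> qs cx hv.
under eq_bigr => j _ do rewrite {1}(qs (u j)) !mulr_suml.
rewrite exchange_big; apply: eq_bigr => l _ /=.
rewrite [in RHS](hv (star l)) mulr_sumr; apply: eq_bigr => j _.
by rewrite -(mulrA l) cx !mulrA.
Qed.

(** Expanding [a * l] on one side and [star l * a] on the other produces the same double sum. *)
Lemma phi_center s x : quasi_basis i E s -> relcomm x -> center (phi s x).
Proof.
move=> qs cx a; rewrite /phi mulr_sumr mulr_suml.
under eq_bigr => l _ do rewrite !mulrA {1}(qs (a * l)) !mulr_suml.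
rewrite exchange_big; apply: eq_bigr => l _ /=.
rewrite -[RHS]mulrA (quasi_basis_adj (star l * a) qs) mulr_sumr.
by apply: eq_bigr => j _; rewrite -(mulrA l) cx !mulrA.
Qed.

Lemma phi_indep s t x : quasi_basis i E s -> quasi_basis i E t -> relcomm x ->
  phi t x = phi s x.
Proof.
move=> qs qt cx.
by apply: (phi_swap (u := id) (v := star) qs cx) => y; exact: quasi_basis_adj.
Qed.

Lemma Ind_phi s : quasi_basis i E s -> Ind i E = phi s 1.
Proof.
move=> qs; have h t : quasi_basis i E t -> \sum_(l <- t) l * star l = phi s 1.
  move=> qt; rewrite -(phi_indep qs qt relcomm1).
  by apply: eq_bigr => l _; rewrite mulr1.
rewrite /Ind; case: xgetP => [x -> [t qt ->]|/(_ (phi s 1))]; first exact: h.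
by case; exists s => //; rewrite h.
Qed.

Lemma windex_phi s : trivial_center A -> quasi_basis i E s ->
  phi s 1 = (windex i E)%:C%:A.
Proof.
move=> tA qs; have [c hc] := tA _ (phi_center qs relcomm1).
have cr : c = (complex.Re c)%:C.
  have : star (phi s 1) = phi s 1 by rewrite phi_star star1.
  by rewrite hc => /scalar_selfadjoint.
rewrite /windex; case: xgetP => [r _|/(_ (complex.Re c))].
  by rewrite (Ind_phi qs).
by case; rewrite /= (Ind_phi qs) hc {1}cr.
Qed.

Lemma windex_uniq s r : trivial_center A -> quasi_basis i E s ->
  phi s 1 = r%:C%:A -> windex i E = r.
Proof. by move=> tA qs; rewrite windex_phi// => /scalar_inj/complexI. Qed.

(** * Conditional expectations twisted by invertibles of the relative commutant *)

Section Twist.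
Variables (g n : A).
Hypotheses (cg : relcomm g) (cn : relcomm n).
Hypotheses (gn : g * n = 1) (ng : n * g = 1) (Eg : E (star g * g) = 1).

Let F x := E (star g * x * g).

Lemma twist_cond_exp : cond_exp i F.
Proof.
split=> [c x y|b|b x b'|x].
- by rewrite /F mulrDr mulrDl -scalerAr -scalerAl E_lin.
- by rewrite /F -mulrA cg mulrA expMr Eg mul1r.
- rewrite /F; have -> : star g * (i b * x * i b') * g =
    i b * (star g * x * g) * i b'.
    rewrite -!mulrA cg !mulrA; congr (_ * _ * _ * _).
    by rewrite (relcomm_star cg).
  by case: hE => _ _ h _; rewrite h.
- by rewrite /F mulrA -starM -mulrA; exact: exp_pos.
Qed.

Lemma twist_quasi_basis s : quasi_basis i E s ->
  quasi_basis i F [seq l * n | l <- s].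
Proof.
move=> qs x; rewrite big_map -[LHS]mulr1 -gn mulrA {1}(qs (x * g)) mulr_suml.
apply: eq_bigr => l _; rewrite /F starM.
have -> : star g * (star n * star l * x) * g = star l * (x * g).
  by rewrite !mulrA -starM ng star1 mul1r.
by rewrite -!mulrA cn.
Qed.

Lemma twist_phi s : phi [seq l * n | l <- s] 1 = phi s (n * star n).
Proof.
by rewrite /phi big_map; apply: eq_bigr => l _; rewrite starM mulr1 !mulrA.
Qed.

End Twist.
End Expectation.

(** Here [w] is the minimal index and [(1 + t^2 r) rho] the index of a competitor, with
    [rho = w - 2 t c] up to order [t^2]. If [c] were nonzero, a small [t] of the same sign would
    push the index below [w]. *)
Lemma first_order_eq0 (R : realType) (K r w c M : R) : 0 <= K -> 0 <= M ->
  (forall t, `|t| * K <= 2^-1 -> 0 < 1 + t ^+ 2 * r ->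
     exists rho, w <= (1 + t ^+ 2 * r) * rho /\
       `|rho - w + 2 * t * c| <= t ^+ 2 * M) -> c = 0.
Proof.
move=> K0 M0 H; apply/eqP/negP => /negP c0.
have ac : 0 < `|c| by rewrite normr_gt0.
(* [D] bounds all second-order terms; the bracket is the bound [S] on [rho] obtained below. *)
pose D := M + `|r| * (`|w| + 2 * `|c| + M) + 1.
have D0 : 0 < D by rewrite /D; have := normr_ge0 r; have := normr_ge0 w; nra.
(* Each summand of [u] yields one smallness condition on [tau = u^-1]: [tK], [tr] and [tD]. *)
pose u := 1 + 2 * K + 2 * `|r| + D / `|c|.
have Dc : 0 < D / `|c| by rewrite divr_gt0.
have u1 : 1 <= u by rewrite /u; have := normr_ge0 r; lra.
pose tau := u^-1; have tu : tau * u = 1 by rewrite mulVf// gt_eqF//; lra.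
have tau0 : 0 < tau by rewrite invr_gt0; lra.
have tau1 : tau <= 1 by rewrite invf_le1; lra.
have tK : tau * K <= 2^-1.
  by move: tu; rewrite /u; have := normr_ge0 r; nra.
have tr : tau * `|r| <= 2^-1.
  by move: tu; rewrite /u; have := normr_ge0 r; nra.
have tD : tau * D <= `|c|.
  have : tau * (D / `|c|) <= 1 by move: tu; rewrite /u; have := normr_ge0 r;
    nra.
  by rewrite mulrA ler_pdivrMr// mul1r.
have [t [tt tc ta]] : exists t, [/\ t ^+ 2 = tau ^+ 2, t * c =
  tau * `|c| & `|t| = tau].
  have [cp|cn] := leP 0 c.
    by exists tau; rewrite (gtr0_norm tau0) (ger0_norm cp).
  by exists (- tau); rewrite normrN (gtr0_norm tau0) (ltr0_norm cn) sqrrN mulNr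
    mulrN.
have tt1 : tau ^+ 2 <= tau by rewrite expr2 ler_piMl// ltW.
have [ler1 ler2] : - `|r| <= r /\ r <= `|r| by rewrite ler_norm lerNl ler_normr
  lexx orbT.
have [lew1 lew2] : - `|w| <= w /\ w <= `|w| by rewrite ler_norm lerNl ler_normr
  lexx orbT.
have r0 := normr_ge0 r.
have w0 := normr_ge0 w.
have [||rho [h1 h2]] := H t.
- by rewrite ta.
- by rewrite tt; nra.
move: h1 h2; rewrite -mulrA tc tt ler_norml => h1 /andP[h2 h3].
set T := tau ^+ 2 in h1 h2 h3 tt1.
have T0 : 0 <= T by rewrite exprn_ge0// ltW.
have T1 : T <= 1 by lra.
pose S := `|w| + 2 * `|c| + M.
have rS : `|rho| <= S.
  rewrite ler_norml /S; apply/andP; split; nra.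
have h4 : T * r * rho <= T * (`|r| * S).
  rewrite -mulrA ler_wpM2l//; apply: le_trans (ler_norm _) _.
  by rewrite normrM ler_wpM2l.
have h5 : 2 * (tau * `|c|) <= T * D.
  by rewrite /D -/S; nra.
have h6 : T * D <= tau * `|c|.
  by rewrite /T expr2 -mulrA ler_wpM2l// ltW.
have : 0 < tau * `|c| by rewrite mulr_gt0.
lra.
Qed.

(** * First-order variation of the index at a minimal expectation *)

Section Minimal.
Variables (R : realType) (A B : cstarType R) (i : B -> A) (E : A -> B).
Hypotheses (hi : unital_embedding i) (mE : minimal_exp i E).
Hypotheses (tA : trivial_center A) (tB : trivial_center B).
Implicit Types (k x : A) (s : seq A).

Let hE : cond_exp i E. Proof. by case: mE => -[]. Qed.
Let i_lin : linear i. Proof. by case: hi. Qed.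
Let E_lin : linear E. Proof. by case: hE. Qed.

(** The competitor is the twist of [E] by [g0 = 1 + t k], normalized. Since [E k = 0],
    [E (g0^2) = 1 + t^2 r]; the scalar [rho] is [phi s] of [g0^-2], which is [1 - 2 t k] to first
    order. *)
Lemma minimal_perturb s k (c r t : R) : quasi_basis i E s ->
  relcomm i k -> star k = k -> E k = 0 ->
  phi s k = c%:C%:A -> E (k * k) = r%:C%:A ->
  `|t| * cnorm k <= 2^-1 -> 0 < 1 + t ^+ 2 * r ->
  exists rho, windex i E <= (1 + t ^+ 2 * r) * rho /\
    `|rho - windex i E + 2 * t * c| <=
      t ^+ 2 * ((\sum_(l <- s) cnorm l ^+ 2) * (8 * cnorm k ^+ 2)).
Proof.
move=> qs ck sk Ek hc hr tk C0.
pose x := t%:C *: k; pose g0 := 1 + x.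
have sx : star x = x by rewrite starZr sk.
have cx : relcomm i x by exact: relcommZ.
have nx : cnorm x <= 2^-1 by rewrite cnormZr.
have [n0 [ng gn]] : invertible g0.
  by rewrite /g0 -[x]opprK; apply: neumann; rewrite cnormN.
have sg : star g0 = g0 by rewrite starD star1 sx.
have sn := star_inv sg ng gn.
have cg : relcomm i g0 by apply: relcommD => //; exact: relcomm1.
have cn := relcomm_inv cg ng gn.
(* From [n0 = 1 - n0 x] and the bound 1/2 on the norm of [x]. *)
have nn0 : cnorm n0 <= 2.
  have e : n0 = 1 - n0 * x by rewrite -ng /g0 mulrDr mulr1 addrK.
  have : cnorm n0 <= 1 + cnorm n0 * cnorm x.
    rewrite {1}e; apply: le_trans (cnormB _ _) _.
    by rewrite cnorm1 lerD2l cnormM.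
  by have := cnorm_ge0 n0; have := cnorm_ge0 x; nra.
pose C := 1 + t ^+ 2 * r; pose a := Num.sqrt C.
have a0 : a != 0 by rewrite gt_eqF// sqrtr_gt0.
have aa : a * a = C by rewrite -expr2 sqr_sqrtr// ltW.
pose g := a^-1%:C *: g0; pose n := a%:C *: n0.
have cg' : relcomm i g by exact: relcommZ.
have cn' : relcomm i n by exact: relcommZ.
have gn' : g * n = 1.
  by rewrite /g /n -scalerAl -scalerAr gn scalerA -rmorphM mulVf// rmorph1
    scale1r.
have ng' : n * g = 1.
  by rewrite /g /n -scalerAl -scalerAr ng scalerA -rmorphM mulfV// rmorph1
    scale1r.
have Eg0 : E (g0 * g0) = C%:C%:A.
  have -> : g0 * g0 = 1 + (x + x) + x * x.
    by rewrite /g0; Ncring_tac.non_commutative_ring.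
  rewrite /x -scalerAl -scalerAr scalerA !(linD E_lin) !(linZ E_lin) Ek hr.
  rewrite scaler0 !addr0 (exp1 hi hE) scalerA -{1}(scale1r 1) -scalerDl.
  by congr (_ *: _); rewrite -(rmorph1 (real_complex R)) -!rmorphM -rmorphD
    -expr2.
have Eg' : E (star g * g) = 1.
  rewrite /g starZr sg -scalerAl -scalerAr scalerA (linZ E_lin) Eg0 scalerA.
  rewrite -!rmorphM -aa.
  have -> : a^-1 * a^-1 * (a * a) = 1 by field.
  by rewrite rmorph1 scale1r.
pose F y := E (star g * y * g).
have qF := twist_quasi_basis cn' gn' ng' qs.
have hF : cond_exp i F := twist_cond_exp hi hE cg' Eg'.
have cnn : relcomm i (n0 * n0) by exact: relcommM.
have [d hd] := tA (phi_center hi hE qs cnn).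
pose rho := complex.Re d.
have dr : d = rho%:C.
  by apply: (@scalar_selfadjoint _ A); rewrite -hd phi_star starM sn.
have wF : windex i F = C * rho.
  apply: (windex_uniq hi hF tA qF).
  rewrite twist_phi /n starZr sn -scalerAl -scalerAr scalerA phiZ hd dr scalerA.
  by rewrite -!rmorphM aa.
exists rho; split.
  by rewrite -wF; apply: (proj2 mE); split;
    [exact: hF | exists [seq l * n | l <- s]].
(* The exact remainder: for [n0 = (1 + x)^-1], [n0^2 - 1 + 2 x = x^2 n0 (n0 + 2)]. The constant 8 is
   the product of the bounds 2 and 4 on the last two factors. *)
pose m := k * k * (n0 * (n0 + (1 + 1))).
have nm : cnorm m <= 8 * cnorm k ^+ 2.
  have k0 := cnorm_ge0 k; have n00 := cnorm_ge0 n0.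
  have h2 : cnorm (n0 + (1 + 1)) <= 4.
    have := cnormD n0 (1 + 1); have := cnormD 1 (1 : A); rewrite cnorm1; lra.
  have h3 : cnorm (n0 * (n0 + (1 + 1))) <= 2 * 4.
    apply: le_trans (cnormM _ _) _; apply: ler_pM => //; exact: cnorm_ge0.
  apply: le_trans (cnormM _ _) _; rewrite mulrC expr2.
  apply: ler_pM; rewrite ?cnorm_ge0//; last exact: cnormM.
  by apply: le_trans h3 _; lra.
have e : n0 * n0 - 1 + (x + x) = (t ^+ 2)%:C *: m.
  have -> : (t ^+ 2)%:C *: m = x * x * (n0 * (n0 + (1 + 1))).
    by rewrite /m /x -!scalerAl -!scalerAr -!scalerAl !scalerA -rmorphM expr2.
  have e1 : x * n0 = 1 - n0 by rewrite -[1]gn /g0 mulrDl mul1r addrC addKr.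
  have e2 : n0 * x = 1 - n0 by rewrite -[1]ng /g0 mulrDr mulr1 addrC addKr.
  have -> : x * x * (n0 * (n0 + (1 + 1))) = x * (x * n0) * (n0 + (1 + 1)).
    by rewrite !mulrA.
  rewrite e1; transitivity ((x - x * n0) * (n0 + (1 + 1))); last first.
    by Ncring_tac.non_commutative_ring.
  rewrite e1; transitivity (x * n0 + (x + x) - (1 - n0) * (n0 + (1 + 1))).
    by rewrite e1; Ncring_tac.non_commutative_ring.
  by Ncring_tac.non_commutative_ring.
have : phi s (n0 * n0 - 1 + (x + x)) = (rho - windex i E + 2 * t * c)%:C%:A.
  rewrite !phiD -scaleN1r phiZ (windex_phi hi hE tA qs) hd dr /x phiZ hc
    !scalerA -!scalerDl.
  congr (_ *: _); rewrite mulN1r -!rmorphM -!rmorphD -rmorphN -!rmorphD.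
  by congr (_ %:C); ring.
rewrite e phiZ => h.
have := cnormAr A (rho - windex i E + 2 * t * c); rewrite -h => <-.
rewrite cnormZr ger0_norm ?sqr_ge0// ler_wpM2l ?sqr_ge0//.
apply: le_trans (phi_norm _ _) _; rewrite ler_wpM2l//.
by apply: sumr_ge0 => l _; rewrite sqr_ge0.
Qed.

(** On the relative commutant [E] is scalar-valued, so subtracting a scalar reduces a self-adjoint
    [x] to the case [E k = 0]. There [phi s k] is a scalar, killed by [first_order_eq0]. *)
Lemma minimal_phi s x : quasi_basis i E s -> relcomm i x ->
  phi s x = (windex i E)%:C *: i (E x).
Proof.
move=> qs cx.
have key k : relcomm i k -> star k = k -> E k = 0 -> phi s k = 0.
  move=> ck sk Ek.
  have [c hc] := tA (phi_center hi hE qs ck).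
  have cr : c = (complex.Re c)%:C.
    by apply: (@scalar_selfadjoint _ A); rewrite -hc phi_star sk.
  have [r hr] := tB (exp_relcomm hi hE (relcommM ck ck)).
  have rr : r = (complex.Re r)%:C.
    by apply: (@scalar_selfadjoint _ B); rewrite -hr -(exp_star hi hE) starM sk.
  rewrite cr in hc; rewrite rr in hr.
  have c0 : complex.Re c = 0.
    apply: (first_order_eq0 (cnorm_ge0 k) _ (fun t : R => minimal_perturb qs ck
      sk Ek hc hr)).
    apply: mulr_ge0; last by rewrite mulr_ge0 ?sqr_ge0.
    by apply: sumr_ge0 => l _; rewrite sqr_ge0.
  by rewrite hc c0 scale0r.
have real k : relcomm i k -> star k = k -> phi s k = (windex i E)%:C *: i (E k).
  move=> ck sk; have [c hc] := tB (exp_relcomm hi hE ck).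
  have cr : c = (complex.Re c)%:C.
    by apply: (@scalar_selfadjoint _ B); rewrite -hc -(exp_star hi hE) sk.
  have -> : k = (k - c%:A) + c%:A by rewrite subrK.
  rewrite phiD key.
  - rewrite phiZ (windex_phi hi hE tA qs) add0r (linD E_lin) (linB E_lin) hc
      (expA hi hE) subrr add0r.
    by rewrite (embA hi) !scalerA mulrC.
  - by apply: relcommB => //; apply: relcommZ; exact: relcomm1.
  - by rewrite starB sk cr starA conj_real.
  by rewrite (linB E_lin) hc (expA hi hE) subrr.
have [a [b [sa sb xab ax bx]]] := cartesian x.
have ca : relcomm i a by rewrite ax; apply/relcommZ/relcommD/relcomm_star.
have cb : relcomm i b.
  by rewrite bx; apply/relcommZ/relcommZ/relcommB/relcomm_star.
rewrite xab phiD phiZ !real// (linD E_lin) (linZ E_lin) (linD i_lin) (linZ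
  i_lin).
by rewrite scalerDr !scalerA mulrC.
Qed.

End Minimal.

(** * The basic construction *)

Section BasicConstruction.
Variables (R : realType) (A B : cstarType R) (i : B -> A) (E : A -> B).
Hypotheses (hi : unital_embedding i) (hE : cond_exp i E).
Variable s : seq A.
Hypothesis qs : quasi_basis i E s.
Variable A1 : basic_construction i E.
Implicit Types (t u : A1) (x y a : A) (b : B).

Let i_lin : linear i. Proof. by case: hi. Qed.
Let E_lin : linear E. Proof. by case: hE. Qed.

Lemma exp_nondegenerate z : (forall x, E (star x * z) = 0) -> z = 0.
Proof.
move=> h; rewrite (qs z) big1_seq// => l _.
by rewrite h (lin0 i_lin) mulr0.
Qed.

Lemma bc_eltK (T : A -> A) : adjointable i E T -> bc_op (bc_elt A1 T) =1 T.
Proof.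
move=> /(bc_op_onto A1 T) [t ht]; rewrite /bc_elt.
by case: xgetP => [u _ //|/(_ t)/(_ ht)].
Qed.

Lemma bc_op_adjointable t : adjointable i E (bc_op t).
Proof. by apply/(bc_op_onto A1); exists t. Qed.

Lemma bc_op_linr t : linear (bc_op t).
Proof. by case: (bc_op_adjointable t). Qed.

Lemma bc_op_linl x : linear (fun t => bc_op t x).
Proof. by move=> c t u; exact: bc_op_linear. Qed.

Lemma bc_op_mod t x b : bc_op t (x * i b) = bc_op t x * i b.
Proof. by case: (bc_op_adjointable t). Qed.

Lemma bc_op_sum I (r : seq I) (f : I -> A1) x :
  bc_op (\sum_(j <- r) f j) x = \sum_(j <- r) bc_op (f j) x.
Proof. exact: (lin_sum (bc_op_linl x)). Qed.

Lemma mul_adjointable a : adjointable i E (fun x => a * x).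
Proof.
split=> [c x y|x b|]; first by rewrite mulrDr -scalerAr.
  by rewrite mulrA.
by exists (fun x => star a * x) => x y; rewrite starM -mulrA.
Qed.

Lemma exp_adjointable : adjointable i E (fun x => i (E x)).
Proof.
split=> [c x y|x b|]; first by rewrite E_lin i_lin.
  by rewrite (expMr hi hE) (embM hi).
exists (fun x => i (E x)) => x y.
by rewrite -(emb_star hi) (expMl hi hE) (expMr hi hE) (exp_star hi hE).
Qed.

Local Notation incl := (bc_incl A1).
Local Notation e := (jones A1).

Lemma bc_inclE a x : bc_op (incl a) x = a * x.
Proof. by rewrite (bc_eltK (mul_adjointable a)). Qed.

Lemma jonesE x : bc_op e x = i (E x).
Proof. by rewrite (bc_eltK exp_adjointable). Qed.

Lemma bc_incl_embedding : unital_embedding incl.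
Proof.
split.
- move=> c a a'; apply: bc_op_inj => x.
  by rewrite bc_op_linear !bc_inclE mulrDl -scalerAl.
- split; first by apply: bc_op_inj => x; rewrite bc_inclE bc_op1 mul1r.
  by move=> a a'; apply: bc_op_inj => x; rewrite bc_opM !bc_inclE mulrA.
- move=> a; apply: bc_op_inj => y; rewrite bc_inclE.
  apply/eqP; rewrite -subr_eq0; apply/eqP/exp_nondegenerate => x.
  rewrite mulrBr (linB E_lin) -bc_op_star bc_inclE starM -mulrA subrr//.
- move=> a a' /(congr1 (fun t => bc_op t 1)).
  by rewrite !bc_inclE !mulr1.
Qed.

Let iE := bc_incl_embedding.

Let incl_lin : linear incl. Proof. by case: iE. Qed.

Lemma jones_idem : e * e = e.
Proof. by apply: bc_op_inj => x; rewrite bc_opM !jonesE (expK hE). Qed.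

Lemma jones_star : star e = e.
Proof.
apply: bc_op_inj => y; rewrite jonesE.
apply/eqP; rewrite -subr_eq0; apply/eqP/exp_nondegenerate => x.
rewrite mulrBr (linB E_lin) -bc_op_star jonesE -(emb_star hi).
by rewrite (expMl hi hE) (expMr hi hE) (exp_star hi hE) subrr.
Qed.

(** The range of [e] is [i B], where the right [B]-linear [t] is left multiplication by its value at
    1. *)
Lemma mul_jones t : t * e = incl (bc_op t 1) * e.
Proof.
apply: bc_op_inj => x; rewrite !bc_opM bc_inclE jonesE.
by rewrite -{1}[i _]mul1r bc_op_mod.
Qed.

Lemma jones_mul t : e * t = e * incl (star (bc_op (star t) 1)).
Proof.
by rewrite -[LHS]starK starM jones_star mul_jones starM jones_star -(emb_star
  iE).
Qed.

Lemma jones_compress a : e * incl a * e = incl (i (E a)) * e.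
Proof.
apply: bc_op_inj => x; rewrite !bc_opM !bc_inclE !jonesE.
by rewrite (expMr hi hE) (embM hi).
Qed.

Lemma jones_comm b : e * incl (i b) = incl (i b) * e.
Proof.
apply: bc_op_inj => x; rewrite !bc_opM !bc_inclE !jonesE.
by rewrite (expMl hi hE) (embM hi).
Qed.

Lemma jones_resolution : \sum_(l <- s) incl l * e * incl (star l) = 1.
Proof.
apply: bc_op_inj => x; rewrite bc_op1 bc_op_sum {2}(qs x).
by apply: eq_bigr => l _; rewrite !bc_opM !bc_inclE jonesE.
Qed.

(* E (x^* x) = 0 makes x e a square root of zero in the C*-algebra A1. *)
Lemma exp_faithful x : E (star x * x) = 0 -> x = 0.
Proof.
move=> h; have : incl x * e = 0.
  apply: star_sqr_eq0; rewrite starM jones_star -(emb_star iE).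
  transitivity (e * incl (star x * x) * e); first by rewrite (embM iE) !mulrA.
  by rewrite jones_compress h (lin0 i_lin) (lin0 incl_lin) mul0r.
move=> /(congr1 (fun t => bc_op t 1)).
rewrite bc_opM bc_inclE jonesE (exp1 hi hE) (emb1 hi) mulr1 => ->.
exact: (lin0 (bc_op_linl 1)).
Qed.

(** Commuting with left multiplications makes [z] the right multiplication by [t = z 1]; commuting
    with [e] puts [t] in [i B]; and [B]-linearity of [z] makes [E t] central in [B]. *)
Lemma bc_trivial_center : trivial_center B -> trivial_center A1.
Proof.
move=> tB z cz; set t := bc_op z 1.
have zt a : bc_op z a = a * t.
  by rewrite -{1}[a]mulr1 -bc_inclE -bc_opM -cz bc_opM bc_inclE.
have tE : t = i (E t).
  have := congr1 (fun u => bc_op u 1) (cz e).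
  rewrite !bc_opM jonesE (jonesE 1) (exp1 hi hE) (emb1 hi) => /esym.
  by [].
have [|c hc] := tB (E t).
  (* Centrality is checked after applying the injective [i]. *)
  move=> b; apply: (let: And4 _ _ _ h := hi in h).
  rewrite !(embM hi) -tE.
  by have := zt (i b); rewrite -{1}[i b]mul1r bc_op_mod.
exists c; apply: bc_op_inj => x.
rewrite zt tE hc (embA hi) (linZ (bc_op_linl x)) bc_op1.
by rewrite -scalerAr mulr1.
Qed.

End BasicConstruction.

(** * The dual expectation and its value at the Jones projection *)

Section DualExpectation.
Variables (R : realType) (A B : cstarType R) (i : B -> A) (E : A -> B).
Hypotheses (hi : unital_embedding i) (mE : minimal_exp i E).
Hypotheses (tA : trivial_center A) (tB : trivial_center B).
Variables (A1 : basic_construction i E) (E1 : A1 -> A).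
Hypothesis mE1 : minimal_exp (bc_incl A1) E1.

Let hE : cond_exp i E. Proof. by case: mE => -[]. Qed.
Let hE1 : cond_exp (bc_incl A1) E1. Proof. by case: mE1 => -[]. Qed.
Let i_lin : linear i. Proof. by case: hi. Qed.
Let E_lin : linear E. Proof. by case: hE. Qed.
Let E1_lin : linear E1. Proof. by case: hE1. Qed.

Local Notation incl := (bc_incl A1).
Local Notation e := (jones A1).
Local Notation h := (E1 e).
Local Notation w := (windex i E).
Local Notation d := (windex incl E1).

Variables (s : seq A) (s1 : seq A1).
Hypotheses (qs : quasi_basis i E s) (qs1 : quasi_basis incl E1 s1).

Let hincl := bc_incl_embedding hi hE qs A1.

Lemma dual_jones_relcomm : relcomm i h.
Proof.
move=> b; rewrite -(expMl hincl hE1) -(expMr hincl hE1).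
by rewrite (jones_comm hi hE).
Qed.

Lemma dual_jones_star : star h = h.
Proof. by rewrite -(exp_star hincl hE1) (jones_star hi hE qs). Qed.

Lemma dual_sandwich a b : E1 (incl a * e * incl b) = a * h * b.
Proof. by rewrite (expMr hincl hE1) (expMl hincl hE1). Qed.

Lemma dual_jones_phi : phi s h = 1.
Proof.
rewrite -(exp1 hincl hE1) -(jones_resolution hi hE qs A1) (lin_sum E1_lin).
by apply: eq_bigr => l _; rewrite dual_sandwich.
Qed.

(** Expanding [e] along the quasi-basis of [E1] factors it as [incl h * k], because
    [e * m = e * incl a] for some [a]. Evaluating at 1 gives a right inverse of [h], and
    self-adjointness of [h] makes it two-sided. *)
Lemma dual_jones_inv : exists v, v * h = 1 /\ h * v = 1.
Proof.
pose k := \sum_(m <- s1) incl (star (bc_op (star m) 1)) * star m.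
have ek : e = incl h * k.
  rewrite {1}(quasi_basis_adj hincl hE1 e qs1) mulr_sumr; apply: eq_bigr => m _.
  by rewrite (jones_mul hi hE qs) (expMr hincl hE1) (embM hincl) mulrA.
have hv : h * bc_op k 1 = 1.
  have := congr1 (fun t => bc_op t 1) ek.
  by rewrite bc_opM bc_inclE (jonesE hi hE) (exp1 hi hE) (emb1 hi).
exists (bc_op k 1); split=> //.
have hv' : star (bc_op k 1) * h = 1.
  by rewrite -dual_jones_star -starM hv star1.
suff <- : star (bc_op k 1) = bc_op k 1 by [].
by rewrite -[LHS]mulr1 -[X in _ * X = _]hv mulrA hv' mul1r.
Qed.

Section Right.
Variable n : A.
Hypothesis cn : relcomm i n.

(* Right multiplication by n, as an element of A' :&: A1. *)
Let Rn := \sum_(l <- s) incl (l * n) * e * incl (star l).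

Lemma bc_op_right x : bc_op Rn x = x * n.
Proof.
rewrite bc_op_sum {2}(qs x) mulr_suml; apply: eq_bigr => l _.
by rewrite !bc_opM !bc_inclE (jonesE hi hE) -!mulrA cn.
Qed.

(** [minimal_phi] for [E1] is applied to [Rn]: its expectation is computed by [minimal_phi] for [E],
    and its image under [phi s1] directly as the scalar [E (v * n)]. *)
Lemma dual_jones_eq v : v * h = 1 -> h * v = 1 ->
  E (v * n) = (d * w)%:C *: E (n * h).
Proof.
move=> vh hv.
have cv : relcomm i v := relcomm_inv dual_jones_relcomm vh hv.
have cR : relcomm incl Rn.
  move=> a; apply: bc_op_inj => x.
  by rewrite !bc_opM !bc_inclE !bc_op_right mulrA.
have [c hc] := tB (exp_relcomm hi hE (relcommM cv cn)).
have [c' hc'] := tB (exp_relcomm hi hE (relcommM cn dual_jones_relcomm)).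
have E1R : incl (E1 Rn) = (w%:C * c')%:A.
  have -> : E1 Rn = phi s (n * h).
    by rewrite (lin_sum E1_lin); apply: eq_bigr => l _;
      rewrite dual_sandwich !mulrA.
  rewrite (minimal_phi hi mE tA tB qs (relcommM cn dual_jones_relcomm)) hc'.
  by rewrite (embA hi) scalerA (embA hincl).
have PR : phi s1 Rn = c%:A.
  (* The elements [l e v] and [e l^*] form a dual pair for [E1], since
     [E1 (y l e v) = y(l) h v = y(l)]. *)
  rewrite -(phi_swap (t := s) (u := fun l => incl l * e * incl v)
    (v := fun l => e * incl (star l)) qs1 cR); last first.
    move=> y; apply: bc_op_inj => x; rewrite bc_op_sum.
    rewrite {1}(qs x) (lin_sum (bc_op_linr y)); apply: eq_bigr => l _.
    have -> : E1 (y * (incl l * e * incl v)) = bc_op y l.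
      rewrite !mulrA (mul_jones hi hE) dual_sandwich bc_opM bc_inclE mulr1.
      by rewrite -mulrA hv mulr1.
    by rewrite !bc_opM !bc_inclE (jonesE hi hE) bc_op_mod.
  apply: bc_op_inj => x; rewrite bc_op_sum (linZ (bc_op_linl x)) bc_op1.
  rewrite {2}(qs x) scaler_sumr; apply: eq_bigr => l _.
  rewrite !bc_opM !bc_inclE bc_op_right !(jonesE hi hE).
  rewrite mulrA -cv -mulrA (expMl hi hE) hc -scalerAr mulr1 (linZ i_lin).
  by rewrite -scalerAr.
have := minimal_phi hincl mE1 (bc_trivial_center hi hE (A1 := A1) tB) tA qs1 cR.
rewrite PR E1R scalerA => /scalar_inj cc.
by rewrite hc hc' cc scalerA rmorphM mulrA.
Qed.

End Right.

(* Minimality of E and of E1 makes v = h^-1 proportional to h, so that h is a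
   positive square root of a scalar. *)
Lemma dual_jones : 0 < w /\ h = w^-1%:C%:A.
Proof.
have [v [vh hv]] := dual_jones_inv.
have ch := dual_jones_relcomm; have sh := dual_jones_star.
have cv := relcomm_inv ch vh hv; have sv := star_inv sh vh hv.
pose D := d * w; pose k := D%:C *: h - v.
have ck : relcomm i k by apply: relcommB => //; exact: relcommZ.
have sk : star k = k by rewrite /k starB starZr sh sv.
have vk : v * k = k * v by rewrite /k mulrBr mulrBl -scalerAr -scalerAl vh hv.
(* [dual_jones_eq] at [n = k] says precisely that [E (k * k) = 0]. *)
have k0 : k = 0.
  apply: (exp_faithful hi hE qs A1); rewrite sk {1}/k mulrBl -scalerAl.
  have -> : h * k = k * h by rewrite /k mulrBr mulrBl -scalerAr -scalerAl vh hv.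
  rewrite (linB E_lin) (linZ E_lin) (dual_jones_eq ck vh hv).
  by rewrite subrr.
have vD : v = D%:C *: h by apply/esym/subr0_eq.
have hh : D%:C *: (h * h) = 1 by rewrite scalerAl -vD.
have D0 : D != 0.
  apply/eqP => D0; move: hh; rewrite D0 scale0r => /esym/eqP.
  by rewrite oner_eq0.
have {}hh : h * h = D^-1%:C%:A.
  by rewrite -hh scalerA -rmorphM mulVf// rmorph1 scale1r.
have D1 : 0 < D^-1.
  rewrite lt_neqAle eq_sym invr_eq0 D0 /=; apply: (@positive_ge0 _ B).
  by have := exp_pos hE h; rewrite sh hh (expA hi hE).
pose c := Num.sqrt D^-1.
have c0 : 0 < c by rewrite sqrtr_gt0.
have cc : c * c = D^-1 by rewrite -expr2 sqr_sqrtr// ltW.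
(* As [h^2 = c^2], [x] satisfies [h x = - c x]. Then [E (x h x) = - c E (x^2)] and [E (x^2)] are
   both nonnegative scalars, so [E (x^2) = 0]. *)
pose x := h - c%:C%:A.
have cx : relcomm i x by apply/relcommB/relcommZ/relcomm1.
have sx : star x = x by rewrite starB sh starA conj_real.
have hx : h * x = - (c%:C *: x).
  rewrite /x mulrBr hh -scalerAr mulr1 scalerBr scalerA -rmorphM cc.
  by rewrite opprB.
have [r hr] := tB (exp_relcomm hi hE (relcommM cx cx)).
have rr : r = (complex.Re r)%:C.
  by apply: (@scalar_selfadjoint _ B); rewrite -hr -(exp_star hi hE) starM sx.
rewrite rr in hr.
have r0 : 0 <= complex.Re r.
  by apply: (@positive_ge0 _ B); have := exp_pos hE x; rewrite sx hr.
have r1 : 0 <= - (c * complex.Re r).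
  apply: (@positive_ge0 _ B); rewrite rmorphN rmorphM scaleNr -scalerA -hr.
  rewrite -(linZ E_lin) -(linN E_lin) scalerAr -mulrN -hx mulrA -dual_sandwich.
  have -> : incl x * e * incl x = star (e * incl x) * (e * incl x).
    rewrite starM (jones_star hi hE qs) -(emb_star hincl) sx !mulrA.
    by rewrite -(mulrA _ e e) (jones_idem hi hE).
  by have [y ->] := exp_pos hE1 (e * incl x); exact: (exp_pos hE).
have {r0 r1} r0 : complex.Re r = 0 by nra.
have x0 : x = 0.
  by apply: (exp_faithful hi hE qs A1); rewrite sx hr r0 scale0r.
have hc : h = c%:C%:A by apply/subr0_eq.
(* Compares [phi s h = 1] with [phi s h = w E h]. *)
have wc : w * c = 1.
  have := minimal_phi hi mE tA tB qs ch.
  rewrite dual_jones_phi hc (expA hi hE) (embA hi) scalerA -rmorphM.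
  rewrite -[in LHS](scale1r 1) -(rmorph1 (real_complex R)).
  by move=> /scalar_inj/complexI.
have w0 : w != 0 by apply/eqP => w0; move: wc; rewrite w0 mul0r; lra.
have cw : c = w^-1 by rewrite -[LHS]mul1r -(mulVf w0) -mulrA wc mulr1.
by rewrite -cw hc; split=> //; rewrite -invr_gt0 -cw.
Qed.

End DualExpectation.

Lemma scalar_ofA (R : realType) (A : cstarType R) (c : R[i]) :
  scalar_of (c%:A : A) = c.
Proof.
rewrite /scalar_of; case: xgetP => [d _ /scalar_inj //|/(_ c)].
by case.
Qed.

(** * The Fourier transform of the Jones projection *)

Section Fourier.
Variables (R : realType) (A B : cstarType R) (i : B -> A) (E : A -> B).
Hypotheses (hi : unital_embedding i) (mE : minimal_exp i E).
Hypotheses (tA : trivial_center A) (tB : trivial_center B).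
Variables (A1 : basic_construction i E) (E1 : A1 -> A).
Hypothesis mE1 : minimal_exp (bc_incl A1) E1.
Variable A2 : basic_construction (bc_incl A1) E1.

Let hE : cond_exp i E. Proof. by case: mE => -[]. Qed.
Let hE1 : cond_exp (bc_incl A1) E1. Proof. by case: mE1 => -[]. Qed.

Local Notation e1 := (jones A1).
Local Notation e2 := (jones A2).
Local Notation w := (windex i E).

Variables (s : seq A) (s1 : seq A1).
Hypotheses (qs : quasi_basis i E s) (qs1 : quasi_basis (bc_incl A1) E1 s1).

Let hincl := bc_incl_embedding hi hE qs A1.
Let hincl2 := bc_incl_embedding hincl hE1 qs1 A2.

(** On [x] the left side acts as [e1 E1 (e1 x)]. Writing [e1 x = e1 a] with [a] in [A] turns this
    into [e1 h a], with [h = w^-1]. *)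
Lemma jones_temperley_lieb :
  bc_incl A2 e1 * e2 * bc_incl A2 e1 = w^-1%:C *: bc_incl A2 e1.
Proof.
have [_ he] := dual_jones hi mE tA tB mE1 qs qs1.
apply: bc_op_inj => x.
rewrite !bc_opM (linZ (bc_op_linl x)) !bc_inclE (jonesE hincl hE1).
rewrite (jones_mul hi hE qs x) (expMr hincl hE1) he (embM hincl) (embA hincl).
by rewrite -scalerAl mul1r -scalerAr.
Qed.

(** The conjugates of [e1] by the quasi-basis sum to 1, leaving the powers [3 - 2 - 2 = -1] of
    [sqrt w]. *)
Lemma fourier_jones : fourier A2 s e1 = (Num.sqrt w)^-1%:C%:A.
Proof.
have [w0 _] := dual_jones hi mE tA tB mE1 qs qs1.
rewrite /fourier /commutant_exp jones_temperley_lieb.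
have -> : \sum_(l <- s) bc_incl A2 (bc_incl A1 l) * (w^-1%:C *: bc_incl A2 e1) *
    bc_incl A2 (bc_incl A1 (star l)) = w^-1%:C%:A.
  rewrite -(emb1 hincl2) -(jones_resolution hi hE qs A1).
  have incl2_lin : linear (bc_incl A2) by case: hincl2.
  rewrite (lin_sum incl2_lin) scaler_sumr; apply: eq_bigr => l _.
  by rewrite !(embM hincl2) -scalerAr -scalerAl.
rewrite !scalerA -!rmorphM; congr (_ %:C *: _).
have r0 : Num.sqrt w != 0 by rewrite gt_eqF// sqrtr_gt0.
have ww : w = Num.sqrt w ^+ 2 by rewrite sqr_sqrtr// ltW.
by move: (Num.sqrt w) r0 ww => q r0 ->; field.
Qed.

End Fourier.

(** * Entropy of the angle operator and of its Fourier transform *)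

Theorem proposition3p4 (R : realType) (A B C D : cstarType R)
    (iB : B -> A) (iC : C -> A) (iD : D -> A)
    (EB : A -> B) (EC : A -> C) (ED : A -> D)
    (hA : simple A) (hB : simple B) (hC : simple C) (hD : simple D)
    (hiB : unital_embedding iB) (hiC : unital_embedding iC)
    (hiD : unital_embedding iD)
    (hBC : range iB `<=` range iC) (hBD : range iB `<=` range iD)
    (hEB : minimal_exp iB EB) (hEC : minimal_exp iC EC)
    (hED : minimal_exp iD ED)
    (hCD : forall x, iC (EC (iD (ED x))) = iB (EB x))
    (hDC : forall x, iD (ED (iC (EC x))) = iB (EB x))
    (A1 : basic_construction iB EB) (E1 : A1 -> A)
    (hE1 : minimal_exp (bc_incl A1) E1)
    (A2 : basic_construction (bc_incl A1) E1) (E2 : A2 -> A1)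
    (hE2 : minimal_exp (bc_incl A2) E2)
    (lambda : seq A) (hlambda : quasi_basis iB EB lambda) :
  let eC := bc_elt A1 (fun x => iC (EC x)) in
  let eD := bc_elt A1 (fun x => iD (ED x)) in
  let Theta : A1 := eC * eD in
  let FTheta : A2 := fourier A2 lambda Theta in
  entropy (tr1 E1) (star Theta * Theta) = 0 /\
  entropy (tr2 E2) (star FTheta * FTheta) = (eta (windex iB EB)^-1)%:C.
Proof.
have tA := simple_trivial_center hA; have tB := simple_trivial_center hB.
have hE : cond_exp iB EB by case: hEB => -[].
have cC : cond_exp iC EC by case: hEC => -[].
have cD : cond_exp iD ED by case: hED => -[].
have hE1' : cond_exp (bc_incl A1) E1 by case: hE1 => -[].
have hE2' : cond_exp (bc_incl A2) E2 by case: hE2 => -[].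
have [s1 qs1] : exists s1, quasi_basis (bc_incl A1) E1 s1 by case: hE1 => -[].
have hincl := bc_incl_embedding hiB hE hlambda A1.
have hincl2 := bc_incl_embedding hincl hE1' qs1 A2.
(* Compatibility of the expectations follows from the commuting square and the idempotence of
   [EC]. *)
have EBC x : EB (iC (EC x)) = EB x.
  case: hiB => _ _ _; apply.
  by rewrite -hDC (expK cC) hDC.
have EBD x : EB (iD (ED x)) = EB x.
  case: hiB => _ _ _; apply.
  by rewrite -hCD (expK cD) hCD.
(* Adjointability ensures that [eC] and [eD] really act as the expectations, rather than being
   default values of [bc_elt]. *)
have adj (G : cstarType R) (j : G -> A) (F : A -> G) :
    unital_embedding j -> cond_exp j F -> range iB `<=` range j ->
    (forall x, EB (j (F x)) = EB x) -> adjointable iB EB (fun x => j (F x)).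
  move=> hj hF hr EF.
  have j_lin : linear j by case: hj.
  have F_lin : linear F by case: hF.
  split=> [c x y|x b|]; first by rewrite F_lin j_lin.
    have [g _ <-] := hr (iB b) (imageP _ I).
    by rewrite (expMr hj hF) (embM hj).
  exists (fun x => j (F x)) => x y.
  rewrite -(emb_star hj) -(EF (_ * y)) (expMl hj hF) -(exp_star hj hF).
  by rewrite -(EF (star x * _)) (expMr hj hF).
move=> eC eD Theta FTheta.
have TE : Theta = jones A1.
  apply: bc_op_inj => x; rewrite bc_opM (jonesE hiB hE).
  rewrite (bc_eltK A1 (adj _ _ _ hiC cC hBC EBC)) (bc_eltK A1 (adj _ _ _ hiD cD
    hBD EBD)).
  exact: hCD.
split.
  rewrite /entropy TE (jones_star hiB hE hlambda) (jones_idem hiB hE).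
  rewrite fun_calc_idem; first 1 last.
  - exact: (jones_idem hiB hE).
  - by rewrite /eta ltxx.
  - by rewrite /eta ltr01 ln1 mulr0 oppr0.
  rewrite /tr1 -(scale0r (1 : A1)) (expA hincl hE1') (expA hiB hE).
  exact: scalar_ofA.
have [w0 _] := dual_jones hiB hEB tA tB hE1 hlambda qs1.
(* The squared modulus is a scalar, so the entropy is [eta] at that scalar. *)
have -> : star FTheta * FTheta = (windex iB EB)^-1%:C%:A.
  rewrite /FTheta TE (fourier_jones hiB hEB tA tB hE1 A2 hlambda qs1).
  rewrite starA conj_real -scalerAl mul1r scalerA -rmorphM; congr (_ %:C *: _).
  by rewrite -invfM -expr2 sqr_sqrtr// ltW.
rewrite /entropy fun_calc_scalar /tr2 (expA hincl2 hE2') (expA hincl hE1').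
by rewrite (expA hiB hE) scalar_ofA.
Qed.
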